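(* Let $M$ be a normal complex contact metric manifold of complex dimension $2n+1$ with local vertical vector fields $U$ and $V=-JU$, and let $\rho$ be its Ricci tensor. Then for any horizontal vector field $X$ (section of $\mathcal{H}$) $$\rho(X,U)=\rho(X,V)=0,$$ and $$\rho(U,U)=\rho(V,V)=4n-2\,d\sigma(U,V),\qquad \rho(U,V)=0.$$
   Context: A complex contact manifold is a complex manifold $M$ of complex dimension $2n+1$ with an open covering by coordinate neighborhoods $\mathcal{U}$, each carrying a holomorphic 1-form $\theta$ with $\theta\wedge(d\theta)^n\neq 0$, such that on overlaps $\theta'=f\theta$ with $f$ holomorphic and non-vanishing. The horizontal distribution is $\mathcal{H}=\ker\theta$. A complex almost contact metric manifold is a Hermitian manifold $(M,J,g)$ with an open covering $\{\mathcal{U}\}$ such that: on each $\mathcal{U}$ there are real 1-forms $u$, $v=u\circ J$, with $g$-dual vector fields $U$, $V=-JU$ (so $u=g(U,\cdot)$, $v=g(V,\cdot)$, $u(U)=v(V)=1$, $u(V)=v(U)=0$), and $(1,1)$-tensors $G$, $H=GJ$ with $H^2=G^2=-I+u\otimes U+v\otimes V$, $GJ=-JG$, $GU=0$, $g(X,GY)=-g(GX,Y)$; and on overlaps $u'=au-bv$, $v'=bu+av$, $G'=aG-bH$, $H'=bG+aH$ for functions $a,b$ with $a^2+b^2=1$. The vertical distribution spanned by $U,V$ is assumed integrable. A complex contact metric manifold is a complex contact manifold with a complex almost contact metric structure such that locally $\theta$ is $u-iv$ up to a non-vanishing complex-valued function (so $\mathcal{H}=\ker u\cap\ker v$), and $du(X,Y)=g(X,GY)+\tfrac12(\sigma(X)v(Y)-\sigma(Y)v(X))$,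 $dv(X,Y)=g(X,HY)-\tfrac12(\sigma(X)u(Y)-\sigma(Y)u(X))$, where $\sigma(X)=g(\nabla_XU,V)$, $\nabla$ is the Levi-Civita connection of $g$, and the convention for 1-forms is $2\,d\omega(X,Y)=X\omega(Y)-Y\omega(X)-\omega([X,Y])$. For a $(1,1)$-tensor $A$ put $[A,A](X,Y)=(\nabla_{AX}A)Y-(\nabla_{AY}A)X-A(\nabla_XA)Y+A(\nabla_YA)X$. Define $S(X,Y)=[G,G](X,Y)+2g(X,GY)U-2g(X,HY)V+2(v(Y)HX-v(X)HY)+\sigma(GY)HX-\sigma(GX)HY+\sigma(X)GHY-\sigma(Y)GHX$, $T(X,Y)=[H,H](X,Y)-2g(X,GY)U+2g(X,HY)V+2(u(Y)GX-u(X)GY)+\sigma(HX)GY-\sigma(HY)GX+\sigma(X)GHY-\sigma(Y)GHX$. The manifold is normal if $S(X,Y)=T(X,Y)=0$ for all $X,Y\in\mathcal{H}$ and $S(X,U)=T(X,V)=0$ for all $X$. Identities involving $G,H,U,V,u,v,\sigma$ are understood on each neighborhood $\mathcal{U}$. Curvature: $R(X,Y)Z=\nabla_X\nabla_YZ-\nabla_Y\nabla_XZ-\nabla_{[X,Y]}Z$. Ricci tensor: $\rho(X,Y)=\sum_a g(R(E_a,X)Y,E_a)$ for a local orthonormal frame $\{E_a\}$ of $TM$. *)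

(* Defs.v *)
From HB Require Import structures.
From mathcomp Require Import all_boot all_order all_algebra all_fingroup.
From mathcomp Require Import complex.
From mathcomp Require Import all_classical all_reals all_analysis.

Set Implicit Arguments.
Unset Strict Implicit.
Unset Printing Implicit Defensive.

Import Order.TTheory GRing.Theory Num.Theory.
Import numFieldNormedType.Exports.

Local Open Scope classical_set_scope.
Local Open Scope complex_scope.
Local Open Scope ring_scope.

(* The topology of [R[i]] is only declared on its alias [R[i]^o]. *)
HB.instance Definition _ (R : rcfType) := NormedModule.copy R[i] R[i]^o.

Fixpoint Ck (R : realType) (V : normedModType R) (k : nat) (O : set V)
    (f : V -> R) : Prop :=
  match k with
  | 0 => forall x, O x -> {for x, continuous f}
  | k'.+1 => (forall x v, O x -> derivable f x v) /\
             (forall v, Ck k' O ('D_v f))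
  end.

(* For [O] open in a finite-dimensional space this is the usual notion. *)
Definition Cinfty (R : realType) (V : normedModType R) (O : set V)
    (f : V -> R) : Prop := forall k, Ck k O f.

(* Differentiability is over the field [R[i]], i.e. complex-linear. *)
Definition holomorphic (R : realType) (m : nat) (V : normedModType R[i])
    (O : set 'rV[R[i]]_m) (f : 'rV[R[i]]_m -> V) : Prop :=
  forall z, O z -> differentiable f z.

Definition cplx (R : realType) (m : nat) (x : 'rV[R]_(m + m)) : 'rV[R[i]]_m :=
  \row_k (x 0 (lshift m k) +i* x 0 (rshift m k)).

(* [cmap] and [cinv] are total functions; only their values on [cdom] and
   on [crange], respectively, matter. *)
Record chart (R : realType) (m : nat) (M : topologicalType) := Chart {
  cdom : set M;
  cmap : M -> 'rV[R[i]]_m;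
  cinv : 'rV[R[i]]_m -> M }.

Definition crange (R : realType) (m : nat) (M : topologicalType)
    (c : chart R m M) (W : set M) : set 'rV[R[i]]_m :=
  cmap c @` (cdom c `&` W).

Definition is_chart (R : realType) (m : nat) (M : topologicalType)
    (c : chart R m M) : Prop :=
  [/\ open (cdom c) /\ open (crange c setT),
      forall p, cdom c p -> cinv c (cmap c p) = p,
      forall p, cdom c p -> {for p, continuous (cmap c)} &
      forall z, crange c setT z -> {for z, continuous (cinv c)}].

Definition holo_transition (R : realType) (m : nat) (M : topologicalType)
    (c c' : chart R m M) : Prop :=
  holomorphic (crange c (cdom c')) (cmap c' \o cinv c).

Record complexManifold (R : realType) (m : nat) := ComplexManifold {
  carrier :> topologicalType;
  atlas : set (chart R m carrier);
  carrier_hausdorff : hausdorff_space carrier;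
  carrier_second_countable : @second_countable carrier;
  atlas_chart : forall c, atlas c -> is_chart c;
  atlas_cover : forall p, exists2 c, atlas c & cdom c p;
  atlas_holo : forall c c', atlas c -> atlas c' -> holo_transition c c';
  atlas_maximal : forall c, is_chart c ->
    (forall c', atlas c' -> holo_transition c c' /\ holo_transition c' c) ->
    atlas c }.

Definition smooth_on (R : realType) (m : nat) (M : complexManifold R m)
    (W : set M) (f : M -> R) : Prop :=
  forall c, atlas c ->
    Cinfty [set x | crange c W (cplx x)] (fun x => f (cinv c (cplx x))).

Definition smooth_at (R : realType) (m : nat) (M : complexManifold R m)
    (p : M) (f : M -> R) : Prop :=
  exists W : set M, [/\ open W, W p & smooth_on W f].

Definition holo_on (R : realType) (m : nat) (M : complexManifold R m)
    (W : set M) (f : M -> R[i]) : Prop :=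
  forall c, atlas c ->
    holomorphic (crange c W) (fun z => f (cinv c z)).

(* Real tangent vectors at [p] are the point derivations of germs of smooth
   functions at [p]. They are represented as functionals on all functions,
   with value 0 on those that are not smooth near [p], so that two tangent
   vectors are equal as derivations iff they are equal as functionals. *)
Definition tvec (R : realType) (m : nat) (M : complexManifold R m) : Type :=
  (M -> R) -> R.

Definition is_tangent (R : realType) (m : nat) (M : complexManifold R m)
    (p : M) (x : tvec M) : Prop :=
  [/\ forall (a : R) f h, smooth_at p f -> smooth_at p h ->
        x (fun q => a * f q + h q) = a * x f + x h,
      forall f h, smooth_at p f -> smooth_at p h ->
        x (fun q => f q * h q) = x f * h p + f p * x h,
      forall f h, smooth_at p f -> smooth_at p h ->
        (\forall q \near p, f q = h q) -> x f = x h &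
      forall f, ~ smooth_at p f -> x f = 0].

Definition dC (R : realType) (m : nat) (M : complexManifold R m)
    (x : tvec M) (f : M -> R[i]) : R[i] :=
  x (fun q => complex.Re (f q)) +i* x (fun q => complex.Im (f q)).

Definition vfield (R : realType) (m : nat) (M : complexManifold R m) : Type :=
  M -> tvec M.

Definition smooth_vfield (R : realType) (m : nat) (M : complexManifold R m)
    (W : set M) (X : vfield M) : Prop :=
  (forall p, W p -> is_tangent p (X p)) /\
  (forall (W' : set M) (f : M -> R), open W' -> W' `<=` W ->
     smooth_on W' f -> smooth_on W' (fun p => X p f)).

Definition bracket (R : realType) (m : nat) (M : complexManifold R m)
    (X Y : vfield M) : vfield M :=
  fun p f => if `[< smooth_at p f >]
             then X p (fun q => Y q f) - Y p (fun q => X q f) else 0.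

Definition push (R : realType) (m k : nat) (M : complexManifold R m)
    (c : 'rV[R]_k -> M) (t e : 'rV[R]_k) : tvec M :=
  fun f => if `[< smooth_at (c t) f >] then 'D_e (f \o c) t else 0.

(* Through every point there is an immersed [k]-dimensional integral
   manifold of the distribution [D], given by a local parametrization. *)
Definition integrable_distribution (R : realType) (m : nat)
    (M : complexManifold R m) (k : nat) (D : M -> set (tvec M)) : Prop :=
  forall p : M, exists (O : set 'rV[R]_k) (c : 'rV[R]_k -> M),
    [/\ [/\ open O, O 0 & c 0 = p],
        forall t, O t -> {for t, continuous c},
        forall (W : set M) (f : M -> R), open W -> smooth_on W f ->
          Cinfty (O `&` c @^-1` W) (f \o c) &
        forall t, O t ->
          (forall e, push c t e = 0 -> e = 0) /\
          (forall x, D (c t) x <-> exists e, x = push c t e)].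

Definition one_form (R : realType) (m : nat) (M : complexManifold R m)
    (W : set M) (w : M -> tvec M -> R) : Prop :=
  (forall p (a : R) (x y : tvec M), W p -> is_tangent p x -> is_tangent p y ->
     w p (a *: x + y) = a * w p x + w p y) /\
  (forall (W' : set M) X, open W' -> W' `<=` W -> smooth_vfield W' X ->
     smooth_on W' (fun p => w p (X p))).

Definition tensor11 (R : realType) (m : nat) (M : complexManifold R m)
    (W : set M) (A : M -> tvec M -> tvec M) : Prop :=
  [/\ forall p x, W p -> is_tangent p x -> is_tangent p (A p x),
      forall p (a : R) (x y : tvec M), W p -> is_tangent p x ->
        is_tangent p y -> A p (a *: x + y) = a *: A p x + A p y &
      forall (W' : set M) X, open W' -> W' `<=` W -> smooth_vfield W' X ->
        smooth_vfield W' (fun p => A p (X p))].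

Definition riemannian (R : realType) (m : nat) (M : complexManifold R m)
    (g : M -> tvec M -> tvec M -> R) : Prop :=
  [/\ forall p (a : R) (x y z : tvec M), is_tangent p x -> is_tangent p y ->
        is_tangent p z -> g p (a *: x + y) z = a * g p x z + g p y z,
      forall p x y, is_tangent p x -> is_tangent p y -> g p x y = g p y x,
      forall p x, is_tangent p x -> x <> 0 -> 0 < g p x x &
      forall (W : set M) X Y, open W -> smooth_vfield W X ->
        smooth_vfield W Y -> smooth_on W (fun p => g p (X p) (Y p))].

Definition dform (R : realType) (m : nat) (M : complexManifold R m)
    (w : M -> tvec M -> R) (X Y : vfield M) (p : M) : R :=
  2^-1 * (X p (fun q => w q (Y q)) - Y p (fun q => w q (X q))
          - w p (bracket X Y p)).

Definition dformC (R : realType) (m : nat) (M : complexManifold R m)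
    (w : M -> tvec M -> R[i]) (X Y : vfield M) (p : M) : R[i] :=
  dform (fun q x => complex.Re (w q x)) X Y p
  +i* dform (fun q x => complex.Im (w q x)) X Y p.

(* [J] is multiplication by [i] on holomorphic coordinates: dz (J x) = i dz x;
   this determines [J] on tangent vectors. *)
Definition complex_structure (R : realType) (m : nat)
    (M : complexManifold R m) (J : M -> tvec M -> tvec M) : Prop :=
  forall p x, is_tangent p x -> is_tangent p (J p x) /\
    (forall c k, atlas c -> cdom c p ->
       dC (J p x) (fun q => cmap c q 0 k)
       = 'i * dC x (fun q => cmap c q 0 k)).

Record hermitian_structure (R : realType) (m : nat) (M : complexManifold R m) :=
  Hermitian {
  hJ : M -> tvec M -> tvec M;
  hg : M -> tvec M -> tvec M -> R;
  hJP : complex_structure hJ;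
  hgP : riemannian hg;
  hgJ : forall p x y, is_tangent p x -> is_tangent p y ->
    hg p (hJ p x) (hJ p y) = hg p x y }.

(* [D p x Y] is the covariant derivative at [p] of the local field [Y] in the
   direction [x]. *)
Record affine_connection (R : realType) (m : nat) (M : complexManifold R m)
    (D : M -> tvec M -> vfield M -> tvec M) : Prop := AffineConnection {
  conn_tangent : forall (W : set M) p x Y, open W -> W p -> is_tangent p x ->
    smooth_vfield W Y -> is_tangent p (D p x Y);
  conn_smooth : forall (W : set M) X Y, open W -> smooth_vfield W X ->
    smooth_vfield W Y -> smooth_vfield W (fun p => D p (X p) Y);
  conn_linear : forall (W : set M) p (a : R) (x y : tvec M) Z, open W -> W p ->
    is_tangent p x -> is_tangent p y -> smooth_vfield W Z ->
    D p (a *: x + y) Z = a *: D p x Z + D p y Z;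
  conn_add : forall (W : set M) p x Y Z, open W -> W p -> is_tangent p x ->
    smooth_vfield W Y -> smooth_vfield W Z ->
    D p x (fun q => Y q + Z q) = D p x Y + D p x Z;
  conn_leibniz : forall (W : set M) p x f Y, open W -> W p -> is_tangent p x ->
    smooth_on W f -> smooth_vfield W Y ->
    D p x (fun q => f q *: Y q) = x f *: Y p + f p *: D p x Y;
  conn_local : forall (W : set M) p x Y Z, open W -> W p -> is_tangent p x ->
    smooth_vfield W Y -> smooth_vfield W Z -> (forall q, W q -> Y q = Z q) ->
    D p x Y = D p x Z }.

Record levi_civita (R : realType) (m : nat) (M : complexManifold R m)
    (g : M -> tvec M -> tvec M -> R)
    (D : M -> tvec M -> vfield M -> tvec M) : Prop := LeviCivita {
  lc_conn : affine_connection D;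
  lc_torsion : forall (W : set M) p X Y, open W -> W p ->
    smooth_vfield W X -> smooth_vfield W Y ->
    D p (X p) Y - D p (Y p) X = bracket X Y p;
  lc_metric : forall (W : set M) p x Y Z, open W -> W p -> is_tangent p x ->
    smooth_vfield W Y -> smooth_vfield W Z ->
    x (fun q => g q (Y q) (Z q)) = g p (D p x Y) (Z p) + g p (Y p) (D p x Z) }.

Definition curvature (R : realType) (m : nat) (M : complexManifold R m)
    (D : M -> tvec M -> vfield M -> tvec M) (X Y Z : vfield M) : vfield M :=
  fun p => D p (X p) (fun q => D q (Y q) Z) - D p (Y p) (fun q => D q (X q) Z)
           - D p (bracket X Y p) Z.

Definition orthonormal_frame (R : realType) (m N : nat)
    (M : complexManifold R m) (g : M -> tvec M -> tvec M -> R) (W : set M)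
    (E : 'I_N -> vfield M) : Prop :=
  [/\ forall a, smooth_vfield W (E a),
      forall p a b, W p -> g p (E a p) (E b p) = (a == b)%:R &
      forall p x, W p -> is_tangent p x ->
        exists k : 'I_N -> R, x = \sum_a k a *: E a p].

Definition ricci (R : realType) (m N : nat) (M : complexManifold R m)
    (g : M -> tvec M -> tvec M -> R) (D : M -> tvec M -> vfield M -> tvec M)
    (E : 'I_N -> vfield M) (X Y : vfield M) (p : M) : R :=
  \sum_a g p (curvature D (E a) X Y p) (E a p).

Definition holo_one_form (R : realType) (m : nat) (M : complexManifold R m)
    (W : set M) (w : M -> tvec M -> R[i]) : Prop :=
  forall c, atlas c -> exists h : 'I_m -> 'rV[R[i]]_m -> R[i],
    (forall k, holomorphic (crange c W) (h k)) /\
    (forall p x, W p -> cdom c p -> is_tangent p x ->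
       w p x = \sum_k h k (cmap c p) * dC x (fun q => cmap c q 0 k)).

(* w /\ (dw)^n evaluated on 2n+1 vector fields, where wedge products are
   alternations normalized by the factorial of the total degree. *)
Definition contact_volume (R : realType) (m n : nat) (M : complexManifold R m)
    (w : M -> tvec M -> R[i]) (X : 'I_(n.*2.+1) -> vfield M) (p : M) : R[i] :=
  ((n.*2.+1)`!%:R)^-1 *
  \sum_(s : 'S_(n.*2.+1)) (-1) ^+ (s : bool) *
    (w p (X (s ord0) p) *
     \prod_(k < n) dformC w (X (s (inord k.*2.+1))) (X (s (inord k.*2.+2))) p).

Record complex_contact (R : realType) (n : nat)
    (M : complexManifold R n.*2.+1) := ComplexContact {
  ctI : Type;
  ctdom : ctI -> set M;
  cttheta : ctI -> M -> tvec M -> R[i];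
  ct_coordinate : forall j, exists2 c, atlas c & ctdom j = cdom c;
  ct_cover : forall p, exists j, ctdom j p;
  ct_holo : forall j, holo_one_form (ctdom j) (cttheta j);
  ct_nondegenerate : forall j p, ctdom j p ->
    exists (W : set M) (X : 'I_(n.*2.+1) -> vfield M),
      [/\ open W /\ W p, forall k, smooth_vfield W (X k) &
          contact_volume (cttheta j) X p <> 0];
  ct_overlap : forall j j', exists f : M -> R[i],
    [/\ holo_on (ctdom j `&` ctdom j') f,
        forall p, ctdom j p -> ctdom j' p -> f p <> 0 &
        forall p x, ctdom j p -> ctdom j' p -> is_tangent p x ->
          cttheta j' p x = f p * cttheta j p x] }.

Definition horizontal (R : realType) (n : nat) (M : complexManifold R n.*2.+1)
    (C : complex_contact M) (p : M) : set (tvec M) :=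
  [set x | is_tangent p x /\
           forall j : ctI C, ctdom j p -> cttheta j p x = 0].

Definition horizontal_vfield (R : realType) (n : nat)
    (M : complexManifold R n.*2.+1) (C : complex_contact M) (W : set M)
    (X : vfield M) : Prop :=
  smooth_vfield W X /\ forall p, W p -> horizontal C p (X p).

Definition vertical_span (R : realType) (m : nat) (M : complexManifold R m)
    (I : Type) (dom : I -> set M) (U V : I -> vfield M) (p : M) :
    set (tvec M) :=
  [set x | exists i, dom i p /\ exists a b : R, x = a *: U i p + b *: V i p].

Record almost_contact (R : realType) (m : nat) (M : complexManifold R m)
    (h : hermitian_structure M) := AlmostContact {
  acI : Type;
  acdom : acI -> set M;
  acu : acI -> M -> tvec M -> R;
  acv : acI -> M -> tvec M -> R;
  acU : acI -> vfield M;
  acV : acI -> vfield M;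
  acG : acI -> M -> tvec M -> tvec M;
  acH : acI -> M -> tvec M -> tvec M;
  ac_open : forall i, open (acdom i);
  ac_cover : forall p, exists i, acdom i p;
  ac_one_forms : forall i,
    one_form (acdom i) (acu i) /\ one_form (acdom i) (acv i);
  ac_vfields : forall i,
    smooth_vfield (acdom i) (acU i) /\ smooth_vfield (acdom i) (acV i);
  ac_tensors : forall i,
    tensor11 (acdom i) (acG i) /\ tensor11 (acdom i) (acH i);
  ac_vE : forall i p x, acdom i p -> is_tangent p x ->
    acv i p x = acu i p (hJ h p x);
  ac_dual : forall i p x, acdom i p -> is_tangent p x ->
    acu i p x = hg h p (acU i p) x /\ acv i p x = hg h p (acV i p) x;
  ac_VE : forall i p, acdom i p -> acV i p = - hJ h p (acU i p);
  ac_unit : forall i p, acdom i p ->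
    [/\ acu i p (acU i p) = 1, acv i p (acV i p) = 1,
        acu i p (acV i p) = 0 & acv i p (acU i p) = 0];
  ac_HE : forall i p x, acdom i p -> is_tangent p x ->
    acH i p x = acG i p (hJ h p x);
  ac_square : forall i p x, acdom i p -> is_tangent p x ->
    acG i p (acG i p x) = - x + acu i p x *: acU i p + acv i p x *: acV i p /\
    acH i p (acH i p x) = - x + acu i p x *: acU i p + acv i p x *: acV i p;
  ac_GJ : forall i p x, acdom i p -> is_tangent p x ->
    acG i p (hJ h p x) = - hJ h p (acG i p x);
  ac_GU : forall i p, acdom i p -> acG i p (acU i p) = 0;
  ac_skew : forall i p x y, acdom i p -> is_tangent p x -> is_tangent p y ->
    hg h p x (acG i p y) = - hg h p (acG i p x) y;
  ac_overlap : forall i i', exists a b : M -> R,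
    forall p x, acdom i p -> acdom i' p -> is_tangent p x ->
      [/\ a p ^+ 2 + b p ^+ 2 = 1,
          acu i' p x = a p * acu i p x - b p * acv i p x,
          acv i' p x = b p * acu i p x + a p * acv i p x,
          acG i' p x = a p *: acG i p x - b p *: acH i p x &
          acH i' p x = b p *: acG i p x + a p *: acH i p x];
  ac_integrable : integrable_distribution 2 (vertical_span acdom acU acV) }.

Definition contact_sigma (R : realType) (m : nat) (M : complexManifold R m)
    (h : hermitian_structure M) (A : almost_contact h)
    (D : M -> tvec M -> vfield M -> tvec M) (i : acI A) (p : M) (x : tvec M) :
    R :=
  hg h p (D p x (acU i)) (acV i p).

Record contact_metric (R : realType) (n : nat) (M : complexManifold R n.*2.+1)
    (h : hermitian_structure M) (D : M -> tvec M -> vfield M -> tvec M)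
    (C : complex_contact M) (A : almost_contact h) : Prop := ContactMetric {
  cm_theta : forall (j : ctI C) (i : acI A), exists f : M -> R[i],
    forall p, ctdom j p -> acdom i p -> f p <> 0 /\
      forall x, is_tangent p x ->
        cttheta j p x = f p * (acu i p x -i* acv i p x);
  cm_du : forall (i : acI A) (W : set M) X Y p, open W -> W `<=` acdom i ->
    smooth_vfield W X -> smooth_vfield W Y -> W p ->
    dform (acu i) X Y p
    = hg h p (X p) (acG i p (Y p))
      + 2^-1 * (contact_sigma D i p (X p) * acv i p (Y p)
                - contact_sigma D i p (Y p) * acv i p (X p));
  cm_dv : forall (i : acI A) (W : set M) X Y p, open W -> W `<=` acdom i ->
    smooth_vfield W X -> smooth_vfield W Y -> W p ->
    dform (acv i) X Y p
    = hg h p (X p) (acH i p (Y p))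
      - 2^-1 * (contact_sigma D i p (X p) * acu i p (Y p)
                - contact_sigma D i p (Y p) * acu i p (X p)) }.

(* (nabla_x A) Y *)
Definition covtensor (R : realType) (m : nat) (M : complexManifold R m)
    (D : M -> tvec M -> vfield M -> tvec M) (A : M -> tvec M -> tvec M)
    (p : M) (x : tvec M) (Y : vfield M) : tvec M :=
  D p x (fun q => A q (Y q)) - A p (D p x Y).

Definition nijenhuis (R : realType) (m : nat) (M : complexManifold R m)
    (D : M -> tvec M -> vfield M -> tvec M) (A : M -> tvec M -> tvec M)
    (X Y : vfield M) (p : M) : tvec M :=
  covtensor D A p (A p (X p)) Y - covtensor D A p (A p (Y p)) X
  - A p (covtensor D A p (X p) Y) + A p (covtensor D A p (Y p) X).

Definition tensorS (R : realType) (m : nat) (M : complexManifold R m)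
    (h : hermitian_structure M) (A : almost_contact h)
    (D : M -> tvec M -> vfield M -> tvec M) (i : acI A) (X Y : vfield M)
    (p : M) : tvec M :=
  let g := hg h p in let G := acG i p in let H := acH i p in
  let v := acv i p in let s := contact_sigma D i p in
  let x := X p in let y := Y p in
  nijenhuis D (acG i) X Y p
  + (2 * g x (G y)) *: acU i p - (2 * g x (H y)) *: acV i p
  + 2 *: (v y *: H x - v x *: H y)
  + s (G y) *: H x - s (G x) *: H y + s x *: G (H y) - s y *: G (H x).

Definition tensorT (R : realType) (m : nat) (M : complexManifold R m)
    (h : hermitian_structure M) (A : almost_contact h)
    (D : M -> tvec M -> vfield M -> tvec M) (i : acI A) (X Y : vfield M)
    (p : M) : tvec M :=
  let g := hg h p in let G := acG i p in let H := acH i p in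
  let u := acu i p in let s := contact_sigma D i p in
  let x := X p in let y := Y p in
  nijenhuis D (acH i) X Y p
  - (2 * g x (G y)) *: acU i p + (2 * g x (H y)) *: acV i p
  + 2 *: (u y *: G x - u x *: G y)
  + s (H x) *: G y - s (H y) *: G x + s x *: G (H y) - s y *: G (H x).

Definition normal_contact (R : realType) (n : nat)
    (M : complexManifold R n.*2.+1)
    (h : hermitian_structure M) (D : M -> tvec M -> vfield M -> tvec M)
    (C : complex_contact M) (A : almost_contact h) : Prop :=
  (forall (i : acI A) (W : set M) X Y p, open W -> W `<=` acdom i ->
     horizontal_vfield C W X -> horizontal_vfield C W Y -> W p ->
     tensorS D i X Y p = 0 /\ tensorT D i X Y p = 0) /\
  (forall (i : acI A) (W : set M) X p, open W -> W `<=` acdom i ->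
     smooth_vfield W X -> W p ->
     tensorS D i X (acU i) p = 0 /\ tensorT D i X (acV i) p = 0).

(* Main.v *)
From HB Require Import structures.
Require Import Defs.
From mathcomp Require Import all_boot all_order all_algebra complex ring lra.
From mathcomp Require Import all_classical all_reals all_analysis.
Set Implicit Arguments.
Unset Strict Implicit.
Unset Printing Implicit Defensive.
Import Order.TTheory GRing.Theory Num.Theory.
Import numFieldNormedType.Exports.
Local Open Scope classical_set_scope.
Local Open Scope ring_scope.

(** The Ricci tensor contracted with a vertical vector only sees the covariant
    derivatives of the vertical fields, and normality determines these
    completely:

      nabla_X U = - G X + sigma(X) V      and      nabla_X V = - H X - sigma(X) U.

    Indeed the formula for du gives the part of nabla U that is skew for g, and
    it makes the vertical leaves totally geodesic; what is left is a symmetric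
    operator B ([shape_op]) acting on horizontal vectors. The condition
    S(X,U) = 0 expresses the derivative of G along U through the commutator of
    B and G, whereas closedness of du expresses it through the anticommutator.
    Comparing both gives B G = 0, so that B = 0 ([shape_op_eq0]).

    From nabla U one computes R(X,Y)U ([curv_U]). Tracing over X,

      rho(Y,U) = - sum_a g((nabla_(E_a) G) Y, E_a) + 2 dsigma(V,Y) + sigma(H Y)

    ([ric_U]). For Y = U the first term is - tr (G^2) = 4n, for Y = V it is a
    trace of the skew operator G H. For horizontal Y two facts are needed. First,
    dsigma(V,Y) = 0, which is closedness of dv evaluated on (V,Y,U)
    ([dsigma2_V_hor]). Second, the horizontal part of (nabla_X G) Y is
    sigma(X) H Y for horizontal X ([cov_G_hor]): after subtracting sigma(X) H,
    closedness of du is the almost Kaehler condition on the horizontal bundle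
    and S = 0 is the integrability condition, and together they make the tensor
    parallel, as for Kaehler manifolds. The trace is then sigma(H Y), and it
    cancels the last term.

    Everything said about U holds for V, because (V, - U, H, - G) satisfies the
    same axioms as (U, V, G, H), with the same sigma and with S and T exchanged
    ([contact_rotated]).

    This argument uses only algebraic identities between functions and vector
    fields on one open set, so it is carried out over an arbitrary commutative
    ring F with a module L of fields, a derivation action, a metric and a
    Levi-Civita connection ([lc_calculus], [contact_calculus]). The geometric
    part then shows that the smooth functions and smooth fields on an open set
    form such a calculus: smooth functions are a ring by the Leibniz rule for
    iterated directional derivatives, and the operations of the manifold
    restrict to it because they are local. *)

(** * Levi-Civita connections over a ring of functions *)

Section Calculus.
Variables (F : comPzRingType) (L : lmodType F).
Variables (der : L -> F -> F) (g : L -> L -> F) (D : L -> L -> L).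

Definition br X Y := D X Y - D Y X.
Definition curv X Y Z := D X (D Y Z) - D Y (D X Z) - D (br X Y) Z.
Definition ric N (E : 'I_N -> L) X Y := \sum_a g (curv (E a) X Y) (E a).
Definition cov (A : L -> L) X Y := D X (A Y) - A (D X Y).
Definition nij (A : L -> L) X Y :=
  cov A (A X) Y - cov A (A Y) X - A (cov A X Y) + A (cov A Y X).

(** The identities of vector calculus on an open set, for F its functions and L
    its fields. The Jacobi identity is not a consequence of the commutator formula,
    as the elements of F need not separate those of L. *)
Record lc_calculus : Prop := LcCalculus {
  two_regular : forall a : F, a + a = 0 -> a = 0;
  derD : forall X a b, der X (a + b) = der X a + der X b;
  derM : forall X a b, der X (a * b) = der X a * b + a * der X b;
  der_linear : forall a X Y f, der (a *: X + Y) f = a * der X f + der Y f;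
  g_sym : forall X Y, g X Y = g Y X;
  g_linear : forall a X Y Z, g (a *: X + Y) Z = a * g X Z + g Y Z;
  g_nondegenerate : forall X, (forall Y, g X Y = 0) -> X = 0;
  D_linear : forall a X Y Z, D (a *: X + Y) Z = a *: D X Z + D Y Z;
  D_add : forall X Y Z, D X (Y + Z) = D X Y + D X Z;
  D_leibniz : forall X a Y, D X (a *: Y) = der X a *: Y + a *: D X Y;
  D_metric : forall X Y Z, der X (g Y Z) = g (D X Y) Z + g Y (D X Z);
  der_br : forall X Y f, der (br X Y) f = der X (der Y f) - der Y (der X f);
  jacobi : forall X Y Z, br (br X Y) Z + br (br Y Z) X + br (br Z X) Y = 0 }.

Section Tensors.
Variables (U V : L) (G H : L -> L).

Definition sigma X := g (D X U) V.
(** This is 2 dsigma in the normalization 2 dw(X,Y) = X w(Y) - Y w(X) - w([X,Y]). *)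
Definition dsigma2 X Y := der X (sigma Y) - der Y (sigma X) - sigma (br X Y).
Definition tensor_S X Y :=
  nij G X Y + (2 * g X (G Y)) *: U - (2 * g X (H Y)) *: V
  + 2 *: (g V Y *: H X - g V X *: H Y)
  + sigma (G Y) *: H X - sigma (G X) *: H Y
  + sigma X *: G (H Y) - sigma Y *: G (H X).
Definition tensor_T X Y :=
  nij H X Y - (2 * g X (G Y)) *: U + (2 * g X (H Y)) *: V
  + 2 *: (g U Y *: G X - g U X *: G Y)
  + sigma (H X) *: G Y - sigma (H Y) *: G X
  + sigma X *: G (H Y) - sigma Y *: G (H X).

Definition hor X := g U X = 0 /\ g V X = 0.

(** The complex structure J does not appear: on horizontal fields it is - G H, and
    on vertical ones it is determined by V = - J U. *)
Record contact_calculus : Prop := ContactCalculus {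
  G_linear : forall a X Y, G (a *: X + Y) = a *: G X + G Y;
  H_linear : forall a X Y, H (a *: X + Y) = a *: H X + H Y;
  gUU : g U U = 1;
  gVV : g V V = 1;
  gUV : g U V = 0;
  GU : G U = 0;
  GV : G V = 0;
  HU : H U = 0;
  HV : H V = 0;
  GG : forall X, G (G X) = - X + g U X *: U + g V X *: V;
  HH : forall X, H (H X) = - X + g U X *: U + g V X *: V;
  HG : forall X, H (G X) = - G (H X);
  G_skew : forall X Y, g X (G Y) = - g (G X) Y;
  H_skew : forall X Y, g X (H Y) = - g (H X) Y;
  d_u : forall X Y, der X (g U Y) - der Y (g U X) - g U (br X Y)
    = 2 * g X (G Y) + (sigma X * g V Y - sigma Y * g V X);
  d_v : forall X Y, der X (g V Y) - der Y (g V X) - g V (br X Y)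
    = 2 * g X (H Y) - (sigma X * g U Y - sigma Y * g U X);
  S_hor : forall X Y, hor X -> hor Y -> tensor_S X Y = 0;
  T_hor : forall X Y, hor X -> hor Y -> tensor_T X Y = 0;
  S_U : forall X, tensor_S X U = 0;
  T_V : forall X, tensor_T X V = 0 }.
End Tensors.

Hypothesis lc : lc_calculus.

Lemma gDl X Y Z : g (X + Y) Z = g X Z + g Y Z.
Proof. by rewrite -[X]scale1r (g_linear lc) mul1r scale1r. Qed.
Lemma g0l Z : g 0 Z = 0.
Proof. by apply: (addIr (g 0 Z)); rewrite -gDl !add0r. Qed.
Lemma gZl a X Z : g (a *: X) Z = a * g X Z.
Proof. by rewrite -[a *: X]addr0 (g_linear lc) g0l addr0. Qed.
Lemma gNl X Z : g (- X) Z = - g X Z.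
Proof. by rewrite -scaleN1r gZl mulN1r. Qed.
Lemma gDr X Y Z : g X (Y + Z) = g X Y + g X Z.
Proof. by rewrite !(g_sym lc X) gDl. Qed.
Lemma gZr a X Z : g X (a *: Z) = a * g X Z.
Proof. by rewrite !(g_sym lc X) gZl. Qed.
Lemma gNr X Z : g X (- Z) = - g X Z.
Proof. by rewrite !(g_sym lc X) gNl. Qed.
Lemma g0r X : g X 0 = 0.
Proof. by rewrite (g_sym lc) g0l. Qed.
Definition gE := (gDl, gDr, gNl, gNr, gZl, gZr, g0l, g0r).

Lemma g_inj X Y : (forall Z, g X Z = g Y Z) -> X = Y.
Proof.
move=> XY; apply/eqP; rewrite -subr_eq0; apply/eqP.
by apply: (g_nondegenerate lc) => Z; rewrite gDl gNl XY subrr.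
Qed.

Lemma D_addl X Y Z : D (X + Y) Z = D X Z + D Y Z.
Proof. by rewrite -[X]scale1r (D_linear lc) !scale1r. Qed.
Lemma D_0l Z : D 0 Z = 0.
Proof. by apply: (addIr (D 0 Z)); rewrite -D_addl !add0r. Qed.
Lemma D_scalel a X Z : D (a *: X) Z = a *: D X Z.
Proof. by rewrite -[a *: X]addr0 (D_linear lc) D_0l addr0. Qed.
Lemma D_oppl X Z : D (- X) Z = - D X Z.
Proof. by rewrite -scaleN1r D_scalel scaleN1r. Qed.
Lemma D_0r X : D X 0 = 0.
Proof. by apply: (addIr (D X 0)); rewrite -(D_add lc) !add0r. Qed.
Lemma D_oppr X Z : D X (- Z) = - D X Z.
Proof. by apply: (addrI (D X Z)); rewrite -(D_add lc) !subrr D_0r. Qed.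

Lemma der0 X : der X 0 = 0.
Proof. by apply: (addIr (der X 0)); rewrite -(derD lc) !add0r. Qed.
Lemma derN X a : der X (- a) = - der X a.
Proof. by apply: (addrI (der X a)); rewrite -(derD lc) !subrr der0. Qed.
Lemma der1 X : der X 1 = 0.
Proof.
apply: (addIr (der X 1)); rewrite -[in RHS](mul1r 1) (derM lc).
by rewrite mulr1 mul1r add0r.
Qed.
Lemma der2M X a : der X (2 * a) = 2 * der X a.
Proof. by rewrite (derM lc) (derD lc) der1 addr0 mul0r add0r. Qed.

(** Reduces an identity that follows linearly from an equation to a ring identity. *)
Lemma eq_from (c d a b : F) : c = d -> a - b = c - d -> a = b.
Proof. by move=> ->; rewrite subrr => /subr0_eq. Qed.

Lemma two_inj (a b : F) : 2 * a = 2 * b -> a = b.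
Proof.
move=> e; apply/eqP; rewrite -subr_eq0; apply/eqP; apply: (two_regular lc).
have -> : a - b + (a - b) = 2 * a - 2 * b by ring.
by rewrite e subrr.
Qed.

Lemma brC X Y : br X Y = - br Y X.
Proof. by rewrite /br opprB. Qed.

(** Twice the exterior derivative of the 1-form g(W,-). *)
Definition dform2 W X Y := der X (g W Y) - der Y (g W X) - g W (br X Y).

(** The second exterior derivative vanishes: derivatives of functions cancel by the
    commutator formula, brackets by the Jacobi identity. *)
Lemma dform2_closed W X Y Z :
  der X (dform2 W Y Z) + der Y (dform2 W Z X) + der Z (dform2 W X Y)
  = dform2 W (br X Y) Z + dform2 W (br Y Z) X + dform2 W (br Z X) Y.
Proof.
have J : g W (br (br X Y) Z) + g W (br (br Y Z) X) + g W (br (br Z X) Y) = 0.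
  by rewrite -!gDr (jacobi lc) g0r.
rewrite /dform2 !(der_br lc) !(derD lc, derN).
apply/eqP; rewrite -subr_eq0; apply/eqP; rewrite -[RHS]J; ring.
Qed.

Lemma dform2_conn W X Y : dform2 W X Y = g (D X W) Y - g (D Y W) X.
Proof. by rewrite /dform2 !(D_metric lc) /br !gE; ring. Qed.

(** * Vertical derivatives from normality *)

Section Contact.
Variables (U V : L) (G H : L -> L).
Hypothesis hc : contact_calculus U V G H.
Local Notation sg := (sigma U V).
Local Notation ds := (dsigma2 U V).

Lemma GD X Y : G (X + Y) = G X + G Y.
Proof. by rewrite -[X]scale1r (G_linear hc) !scale1r. Qed.
Lemma G0 : G 0 = 0.
Proof. by apply: (addIr (G 0)); rewrite -GD !add0r. Qed.
Lemma GZ a X : G (a *: X) = a *: G X.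
Proof. by rewrite -[a *: X]addr0 (G_linear hc) G0 addr0. Qed.
Lemma GN X : G (- X) = - G X.
Proof. by rewrite -scaleN1r GZ scaleN1r. Qed.
Lemma HD X Y : H (X + Y) = H X + H Y.
Proof. by rewrite -[X]scale1r (H_linear hc) !scale1r. Qed.
Lemma H0 : H 0 = 0.
Proof. by apply: (addIr (H 0)); rewrite -HD !add0r. Qed.
Lemma HZ a X : H (a *: X) = a *: H X.
Proof. by rewrite -[a *: X]addr0 (H_linear hc) H0 addr0. Qed.
Lemma HN X : H (- X) = - H X.
Proof. by rewrite -scaleN1r HZ scaleN1r. Qed.
Lemma gVU : g V U = 0. Proof. by rewrite (g_sym lc) (gUV hc). Qed.

Lemma sigmaD X Y : sg (X + Y) = sg X + sg Y.
Proof. by rewrite /sigma D_addl gDl. Qed.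
Lemma sigmaZ a X : sg (a *: X) = a * sg X.
Proof. by rewrite /sigma D_scalel gZl. Qed.
Lemma sigmaN X : sg (- X) = - sg X.
Proof. by rewrite /sigma D_oppl gNl. Qed.
Lemma sigma0 : sg 0 = 0.
Proof. by rewrite /sigma D_0l g0l. Qed.

Lemma gDUU X : g (D X U) U = 0.
Proof.
have := D_metric lc X U U; rewrite (gUU hc) der1 (g_sym lc U) => e.
exact/(two_regular lc)/esym.
Qed.
Lemma gDVU X : g (D X V) U = - sg X.
Proof.
have := D_metric lc X U V; rewrite (gUV hc) der0 (g_sym lc U) => e.
by apply: (addrI (sg X)); rewrite subrr -e.
Qed.

(** The connection form of the vertical bundle does not depend on the frame up to a
    constant rotation. *)
Lemma sigma_rotated X : sigma V (- U) X = sg X.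
Proof. by rewrite {1}/sigma gNr gDVU opprK. Qed.

Lemma tensor_S_rotated X Y :
  tensor_S V (- U) H (fun Z => - G Z) X Y = tensor_T U V G H X Y.
Proof.
rewrite /tensor_S /tensor_T !sigma_rotated; apply: g_inj => Z.
by rewrite !(gE, HN, HG hc, sigmaN, GN); ring.
Qed.

Lemma tensor_T_rotated X Y :
  tensor_T V (- U) H (fun Z => - G Z) X Y = tensor_S U V G H X Y.
Proof.
rewrite /tensor_S /tensor_T /nij /cov !sigma_rotated; apply: g_inj => Z.
rewrite !(HN, HG hc, sigmaN, D_oppl, D_oppr, GD, GN).
by rewrite !(gE, GN, D_oppl, D_oppr); ring.
Qed.

Lemma tensor_S_oppr X Y : tensor_S U V G H X (- Y) = - tensor_S U V G H X Y.
Proof.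
rewrite /tensor_S /nij /cov; apply: g_inj => Z.
rewrite !(HN, GN, sigmaN, D_oppl, D_oppr, GD).
by rewrite !(gE, GN, D_oppl, D_oppr); ring.
Qed.

(** The quarter turn of the vertical plane. It exchanges du with dv and S with T,
    so that every statement about U has a twin about V. *)
Lemma contact_rotated : contact_calculus V (- U) H (fun X => - G X).
Proof.
have horE X : hor V (- U) X -> hor U V X.
  by case; rewrite gNl /hor => ? /(canRL opprK) ->; rewrite oppr0.
split; rewrite ?gE ?opprK ?HN ?GN ?(GU hc) ?(GV hc) ?(HU hc) ?(HV hc) ?gVU
  ?oppr0//.
- exact: H_linear hc.
- by move=> a X Y; rewrite (G_linear hc) opprD scalerN.
- exact: gVV hc.
- exact: gUU hc.
- by move=> X; rewrite (HH hc) gE scaleNr scalerN opprK addrAC.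
- by move=> X; rewrite GN opprK (GG hc) gE scaleNr scalerN opprK addrAC.
- by move=> X; rewrite HN (HG hc) opprK.
- exact: H_skew hc.
- by move=> X Y; rewrite !gE (G_skew hc).
- by move=> X Y; rewrite !sigma_rotated (d_v hc) !gE; ring.
- move=> X Y; rewrite !sigma_rotated !gE !derN.
  by apply: (eq_from (esym (d_u hc X Y))); rewrite /br !gE; ring.
- by move=> X Y /horE hX /horE hY; rewrite tensor_S_rotated (T_hor hc).
- by move=> X Y /horE hX /horE hY; rewrite tensor_T_rotated (S_hor hc).
- by move=> X; rewrite tensor_S_rotated (T_V hc).
- by move=> X; rewrite tensor_T_rotated tensor_S_oppr (S_U hc) oppr0.
Qed.

Lemma D_U_skew X Y : g (D X U) Y - g (D Y U) X
  = 2 * g X (G Y) + (sg X * g V Y - sg Y * g V X).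
Proof. by rewrite -dform2_conn; exact: d_u hc X Y. Qed.

(** As du(U,-) is a multiple of v, the derivative of U along U has no horizontal
    part: the vertical leaves are totally geodesic. *)
Lemma D_U_U : D U U = sg U *: V.
Proof.
apply: g_inj => Z; apply: (eq_from (D_U_skew U Z)).
by rewrite gDUU (G_skew hc) (GU hc) gVU !gE; ring.
Qed.

Lemma D_V_U : D V U = sg V *: V.
Proof.
apply: g_inj => Z; apply: (eq_from (D_U_skew V Z)).
by rewrite (G_skew hc) (GV hc) (gVV hc) !gE /sigma; ring.
Qed.

Lemma cov_G_skew X Y Z : g Y (cov G X Z) = - g (cov G X Y) Z.
Proof.
have := D_metric lc X Y (G Z).
rewrite (G_skew hc) derN (D_metric lc) /cov => e.
rewrite !gE !(G_skew hc); apply: (eq_from (esym e)).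
by rewrite (G_skew hc); ring.
Qed.

(** Closedness of du, rewritten with the formulas for du and dv. In this form du is
    the sum of the 2-form of G and of half the wedge of sigma and v. *)
Lemma closed_du X Y Z :
  2 * (g Y (cov G X Z) + g Z (cov G Y X) + g X (cov G Z Y))
  + (ds X Y * g V Z + ds Y Z * g V X + ds Z X * g V Y)
  = 2 * (sg X * g Y (H Z) + sg Y * g Z (H X) + sg Z * g X (H Y)).
Proof.
have duE A B : dform2 U A B = 2 * g A (G B) + (sg A * g V B - sg B * g V A).
  exact: d_u hc A B.
have brV A B : g V (br A B) = der A (g V B) - der B (g V A)
    - (2 * g A (H B) - (sg A * g U B - sg B * g U A)).
  by rewrite -(d_v hc); ring.
have DgG A B C : der A (g B (G C)) = g (D A B) (G C)
    + (g B (cov G A C) - g (D A C) (G B)).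
  by rewrite (D_metric lc) /cov !gE (G_skew hc B (D A C)) (g_sym lc (G B)); ring.
have gbr A B C : g (br A B) (G C) = g (D A B) (G C) - g (D B A) (G C).
  by rewrite gDl gNl.
have := dform2_closed U X Y Z; rewrite !duE !(derD lc, derN, der2M, derM lc).
rewrite !DgG !gbr !brV => e; apply: (eq_from e); rewrite /ds; ring.
Qed.

(** The counterpart of the operator h of real contact metric geometry; it vanishes
    when U is an infinitesimal isometry in horizontal directions. *)
Definition shape_op X := D X U + G X - sg X *: V.

Lemma shape_opD X Y : shape_op (X + Y) = shape_op X + shape_op Y.
Proof.
by rewrite /shape_op D_addl GD sigmaD; apply: g_inj => Z; rewrite !gE; ring.
Qed.
Lemma shape_opZ a X : shape_op (a *: X) = a *: shape_op X.
Proof.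
by rewrite /shape_op D_scalel GZ sigmaZ; apply: g_inj => Z; rewrite !gE; ring.
Qed.
Lemma shape_opN X : shape_op (- X) = - shape_op X.
Proof. by rewrite -scaleN1r shape_opZ scaleN1r. Qed.
Lemma shape_opU : shape_op U = 0.
Proof. by rewrite /shape_op D_U_U (GU hc) addr0 subrr. Qed.
Lemma shape_opV : shape_op V = 0.
Proof. by rewrite /shape_op D_V_U (GV hc) addr0 subrr. Qed.

Lemma gGU X : g U (G X) = 0.
Proof. by rewrite (G_skew hc) (GU hc) g0l oppr0. Qed.
Lemma gGV X : g V (G X) = 0.
Proof. by rewrite (G_skew hc) (GV hc) g0l oppr0. Qed.
Lemma gHU X : g U (H X) = 0.
Proof. by rewrite (H_skew hc) (HU hc) g0l oppr0. Qed.
Lemma gHV X : g V (H X) = 0.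
Proof. by rewrite (H_skew hc) (HV hc) g0l oppr0. Qed.
Lemma hor_G X : hor U V (G X).
Proof. by split; rewrite (gGU, gGV). Qed.
Lemma hor_H X : hor U V (H X).
Proof. by split; rewrite (gHU, gHV). Qed.

Lemma GG_hor X : hor U V X -> G (G X) = - X.
Proof. by case=> uX vX; rewrite (GG hc) uX vX !scale0r !addr0. Qed.

Lemma hor_dec X : X = - G (G X) + g U X *: U + g V X *: V.
Proof. by rewrite (GG hc); apply: g_inj => Z; rewrite !gE; ring. Qed.

(** The formula for du says precisely that the skew part of nabla U is that of
    - G + sigma V. *)
Lemma shape_op_sym X Y : g (shape_op X) Y = g (shape_op Y) X.
Proof.
apply: (eq_from (D_U_skew X Y)).
rewrite !gE [g (G X) Y](g_sym lc) !(G_skew hc) [g (G Y) X](g_sym lc).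
by rewrite (G_skew hc); ring.
Qed.

Lemma g_shape_opU X : g U (shape_op X) = 0.
Proof. by rewrite (g_sym lc) shape_op_sym shape_opU g0l. Qed.
Lemma g_shape_opV X : g V (shape_op X) = 0.
Proof. by rewrite (g_sym lc) shape_op_sym shape_opV g0l. Qed.

Lemma G_D_U X : G (D X U) = G (shape_op X) - G (G X).
Proof.
by rewrite /shape_op (GD _ (- _)) (GD _ (G X)) GN GZ (GV hc) scaler0 subr0 addrK.
Qed.

Lemma cov_G_U X : cov G X U = G (G X) - G (shape_op X).
Proof. by rewrite /cov (GU hc) D_0r G_D_U sub0r opprB. Qed.

(** This is S(X,U) = 0: the derivative of G along U is the commutator of B and G, up
    to the term sigma(U) H. *)
Lemma G_cov_U X : G (cov G U X)
  = G (shape_op (G X)) - G (G (shape_op X)) + sg U *: G (H X).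
Proof.
have cov0 W : cov G 0 W = 0 by rewrite /cov !D_0l G0 subr0.
have e := S_U hc X; apply: g_inj => Z; move/(congr1 (g^~ Z)): e.
rewrite /tensor_S /nij (GU hc) (HU hc) cov0 sigma0 G0 !cov_G_U gVU.
move: (cov G U X) (shape_op X) (shape_op (G X)) => C B B'.
by rewrite !(gE, GD, GN) => e; apply: (eq_from e); ring.
Qed.

(** Closedness of du on (U,X,Y) gives the derivative of G along U with the
    anticommutator of B and G in place of the commutator; the difference is
    twice B G. *)
Lemma shape_op_G X Y : hor U V X -> hor U V Y -> g X (shape_op (G Y)) = 0.
Proof.
move=> hX hY; apply: (two_regular lc); apply: two_inj; rewrite mulr0.
have gGG W : g X W = g (G X) (G W) by rewrite (G_skew hc) (GG_hor hX) gNl opprK.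
have [uX vX] := hX; have [uY vY] := hY.
have t1 : g X (cov G U Y)
    = g X (shape_op (G Y)) - g X (G (shape_op Y)) + sg U * g X (H Y).
  by rewrite gGG G_cov_U gDr gDr gNr gZr -!gGG.
have t2 : g Y (cov G X U) = - g Y X + g X (shape_op (G Y)).
  rewrite cov_G_U gDr gNr (GG_hor hX) gNr (G_skew hc) (g_sym lc (G Y)).
  by rewrite shape_op_sym (g_sym lc X) opprK.
have t3 : g U (cov G Y X) = g X (G (shape_op Y)) + g Y X.
  rewrite cov_G_skew cov_G_U gDl gNl (GG_hor hY) gNl (g_sym lc X).
  by rewrite opprD !opprK addrC.
have := closed_du U X Y; rewrite t1 t2 t3 vX vY gVU (HU hc) gHU g0r => e.
by apply: (eq_from e); ring.
Qed.

Lemma shape_op_eq0 X : shape_op X = 0.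
Proof.
(* G G Y exhausts the horizontal fields *)
have s1 Y Z : g (G Z) (shape_op (G (G Y))) = 0.
  by apply: shape_op_G; exact: hor_G.
have s2 Y Z : g Z (shape_op (G (G Y))) = 0.
  rewrite [Z]hor_dec (gDl _ _ (shape_op _)) gDl gNl !gZl s1.
  rewrite g_shape_opU g_shape_opV.
  by rewrite !mulr0 oppr0 !addr0.
rewrite [X]hor_dec !shape_opD !shape_opZ shape_opU shape_opV !scaler0 !addr0.
rewrite shape_opN.
by apply: g_inj => Z; rewrite gNl g0l (g_sym lc) s2 oppr0.
Qed.

Lemma D_U X : D X U = - G X + sg X *: V.
Proof.
have := shape_op_eq0 X; rewrite /shape_op => /subr0_eq <-.
by rewrite addrC addrK.
Qed.

End Contact.
Section VerticalDerivatives.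
Variables (U V : L) (G H : L -> L).
Hypothesis hc : contact_calculus U V G H.
Local Notation sg := (sigma U V).
Local Notation ds := (dsigma2 U V).

Lemma dsigma2_rotated X Y : dsigma2 V (- U) X Y = ds X Y.
Proof. by rewrite /dsigma2 !(sigma_rotated hc). Qed.

Lemma D_V X : D X V = - H X - sg X *: U.
Proof. by rewrite (D_U (contact_rotated hc)) (sigma_rotated hc) scalerN. Qed.

(** Closedness of du on (U,Y,V). The other terms vanish: nabla_U V and
    nabla_V U are vertical, hence killed by G, and nabla_Y U enters only through
    its image under G, which is horizontal. *)
Lemma dsigma2_U_hor Y : hor U V Y -> ds U Y = 0.
Proof.
case=> uY vY; have := closed_du hc U Y V.
have c1 : cov G U V = 0.
  by rewrite /cov (GV hc) D_0r D_V (HU hc) oppr0 !add0r (GN hc) (GZ hc) (GU hc)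
             scaler0 !oppr0.
have c2 : g V (cov G Y U) = 0.
  by rewrite /cov (GU hc) D_0r sub0r gNr (gGV hc) oppr0.
have c3 : g U (cov G V Y) = 0.
  by rewrite (cov_G_skew hc) /cov (GU hc) D_0r (D_V_U hc) (GZ hc) (GV hc)
             scaler0 subr0 g0l oppr0.
rewrite c1 c2 c3 vY (gVU hc) (gVV hc) (HV hc) (gHV hc) (gHU hc) !gE => e.
by apply: (eq_from e); ring.
Qed.

End VerticalDerivatives.

(** * Curvature and Ricci tensor in vertical directions *)

Section RicciAlongU.
Variables (U V : L) (G H : L -> L).
Hypothesis hc : contact_calculus U V G H.
Local Notation sg := (sigma U V).
Local Notation ds := (dsigma2 U V).

Lemma dsigma2_V_hor Y : hor U V Y -> ds V Y = 0.
Proof.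
case=> uY vY; rewrite -(dsigma2_rotated hc).
apply: (dsigma2_U_hor (contact_rotated hc)).
by split; rewrite // gNl uY oppr0.
Qed.

(** The argument that an almost Kaehler structure with vanishing Nijenhuis tensor is
    Kaehler, applied on the horizontal bundle to the derivative of G corrected by
    sigma H. *)
Lemma cov_G_hor X Y Z : hor U V X -> hor U V Y -> hor U V Z ->
  g Y (cov G X Z) = sg X * g Y (H Z).
Proof.
(* P is cyclic because du is closed; given S = 0 this forces it to vanish *)
pose P X Y Z := g Y (cov G X Z) - sg X * g Y (H Z).
have Pskew A B C : P A B C = - P A C B.
  rewrite /P (cov_G_skew hc A B C) (H_skew hc B C) !(g_sym lc C); ring.
(* the derivative of G anticommutes with G because G^2 = -1 on horizontals *)
have PG A B C : hor U V B -> hor U V C -> P A (G B) C = P A B (G C).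
  move=> [uB vB] hC; have e : g B (cov G A (G C)) = - g B (G (cov G A C)).
    rewrite /cov (GG_hor hc hC) D_oppr (GD hc) (GN hc) (GG hc (D A C)).
    move: (D A C) (D A (G C)) => W W'.
    by rewrite !gE (g_sym lc B U) (g_sym lc B V) uB vB; ring.
  rewrite /P e (HG hc) gNr !(G_skew hc B); ring.
have Pcyc A B C : hor U V A -> hor U V B -> hor U V C ->
    P A B C + P B C A + P C A B = 0.
  move=> [_ vA] [_ vB] [_ vC]; apply: two_inj.
  have := closed_du hc A B C; rewrite vA vB vC => e.
  by apply: (eq_from e); rewrite /P; ring.
(* S(A,B) = 0 paired with a horizontal field *)
have PS A B W : hor U V A -> hor U V B -> hor U V W ->
    P (G A) W B - P (G B) W A + P A (G W) B - P B (G W) A = 0.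
  move=> hA hB [uW vW]; have := S_hor hc hA hB; have [_ vA] := hA.
  have [_ vB] := hB; rewrite /tensor_S /nij vA vB => /(congr1 (g W)) e.
  rewrite /P; move: e.
  move: (cov G (G A) B) (cov G (G B) A) (cov G A B) (cov G B A) => c1 c2 c3 c4.
  rewrite !gE !(G_skew hc W) (g_sym lc W U) (g_sym lc W V) uW vW => e.
  by apply: (eq_from e); ring.
(* cyclicity turns the four terms of S into twice a single one *)
have P0 A B W : hor U V A -> hor U V B -> hor U V W -> P W B (G A) = 0.
  move=> hA hB hW; apply: two_inj; have e := PS A B W hA hB hW.
  have e1 := Pcyc (G A) W B (hor_G hc A) hW hB.
  have e2 := Pcyc (G B) W A (hor_G hc B) hW hA.
  rewrite (PG B A W) // (Pskew B A) in e1; rewrite (PG A B W) // (Pskew A B) in e2.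
  rewrite -(PG W A B) // (Pskew W (G A)) in e2.
  apply: (eq_from (esym e)).
  have -> : P (G A) W B = - (P W B (G A) - P B (G W) A).
    by apply: (eq_from e1); ring.
  have -> : P (G B) W A = - (- P W B (G A) - P A (G W) B).
    by apply: (eq_from e2); ring.
  ring.
move=> hX hY hZ; have := P0 (G Z) Y X (hor_G hc Z) hY hX.
rewrite (GG_hor hc hZ) /P /cov (GN hc) (HN hc) !D_oppr (GN hc).
move: (D X (G Z)) (G (D X Z)) => W W'; rewrite !gE => e.
by apply: (eq_from (esym e)); ring.
Qed.

Lemma cov_linear A : (forall a X Y, A (a *: X + Y) = a *: A X + A Y) ->
  forall Y a X Z, cov A (a *: X + Z) Y = a *: cov A X Y + cov A Z Y.
Proof.
move=> Al Y a X Z; rewrite /cov !(D_linear lc) Al scalerBr.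
by apply: g_inj => W; rewrite !gE; ring.
Qed.

Lemma dsigma2_linear Y a X Z : ds (a *: X + Z) Y = a * ds X Y + ds Z Y.
Proof.
have sbr A B : sg (br A B) = sg (D A B) - sg (D B A) by rewrite sigmaD sigmaN.
rewrite /dsigma2 !sbr (der_linear lc) (D_linear lc) (D_add lc) (D_leibniz lc).
rewrite !sigmaD !sigmaZ (derD lc) (derM lc); ring.
Qed.

Lemma curv_U X Y : curv X Y U =
  cov G Y X - cov G X Y + ds X Y *: V + sg X *: H Y - sg Y *: H X.
Proof.
rewrite /curv !(D_U hc) !(D_add lc, D_leibniz lc, D_oppr) !(D_V hc).
rewrite /dsigma2 /cov; have -> : G (br X Y) = G (D X Y) - G (D Y X).
  by rewrite (GD hc) (GN hc).
by apply: g_inj => Z; rewrite !gE; ring.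
Qed.

Section Ricci.
Variables (N : nat) (E : 'I_N -> L).
Hypothesis E_on : forall a b, g (E a) (E b) = (a == b)%:R.
Hypothesis E_span : forall X, X = \sum_a g X (E a) *: E a.

(** The trace of the operator X |-> phi(X) W, which is how every trace below is
    evaluated. *)
Lemma trace_rank_one (phi : L -> F) W :
  (forall a X Y, phi (a *: X + Y) = a * phi X + phi Y) ->
  \sum_a phi (E a) * g W (E a) = phi W.
Proof.
move=> phil; have phiD X Y : phi (X + Y) = phi X + phi Y.
  by rewrite -[X]scale1r phil mul1r scale1r.
have phi0 : phi 0 = 0 by apply: (addIr (phi 0)); rewrite -phiD !add0r.
have phiZ a X : phi (a *: X) = a * phi X.
  by rewrite -[a *: X]addr0 phil phi0 addr0.
rewrite [in RHS](E_span W) (big_morph phi phiD phi0).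
by apply: eq_bigr => a _; rewrite phiZ mulrC.
Qed.

(** The derivative of G along Y and the operator H are skew, hence traceless. *)
Lemma ric_U Y : ric E Y U =
  - \sum_a g (cov G (E a) Y) (E a) + ds V Y + sg (H Y).
Proof.
rewrite -(trace_rank_one V (dsigma2_linear Y)).
have sl a A B : sg (a *: A + B) = a * sg A + sg B by rewrite sigmaD sigmaZ.
rewrite -(trace_rank_one (H Y) sl) -sumrN -!big_split /=.
apply: eq_bigr => a _; rewrite curv_U; move: (E a) => X.
have c0 : g (cov G Y X) X = 0.
  apply: (two_regular lc); have := cov_G_skew hc Y X X.
  by rewrite (g_sym lc X) => {1}->; rewrite addNr.
have h0 : g (H X) X = 0.
  apply: (two_regular lc); have := H_skew hc X X.
  by rewrite (g_sym lc X) => {1}->; rewrite addNr.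
move: (cov G Y X) (cov G X Y) c0 => c1 c2 c0.
by rewrite !gDl !gNl !gZl c0 h0; ring.
Qed.

Lemma dsigma2_antisym X Y : ds X Y = - ds Y X.
Proof. by rewrite /dsigma2 brC sigmaN; ring. Qed.

Lemma ric_U_U : ric E U U = N%:R - 2 - ds U V.
Proof.
rewrite ric_U (HU hc) sigma0 (dsigma2_antisym V).
have gl W a A B : g W (a *: A + B) = a * g W A + g W B by rewrite gDr gZr.
have -> : \sum_a g (cov G (E a) U) (E a)
    = \sum_a (- 1 + g U (E a) * g U (E a) + g V (E a) * g V (E a)).
  apply: eq_bigr => a _; rewrite /cov (GU hc) D_0r (D_U hc) (GD hc) (GN hc).
  rewrite (GZ hc) (GV hc) (GG hc) scaler0 addr0 sub0r opprK !gDl gNl !gZl.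
  by rewrite E_on eqxx.
rewrite !big_split /= (trace_rank_one U (gl U)) (trace_rank_one V (gl V)).
by rewrite (gUU hc) (gVV hc) sumr_const card_ord mulNrn; ring.
Qed.

Lemma ric_V_U : ric E V U = 0.
Proof.
rewrite ric_U (HV hc) sigma0 big1 => [|a _].
  suff -> : ds V V = 0 by rewrite oppr0 !addr0.
  by apply: (two_regular lc); rewrite {1}dsigma2_antisym addNr.
apply: (two_regular lc); move: (E a) => X.
rewrite /cov (GV hc) D_0r (D_V hc) (GD hc) !(GN hc) (GZ hc) (GU hc).
rewrite scaler0 subr0 sub0r opprK.
rewrite -[X in X + _]opprK -(G_skew hc) (g_sym lc (H X)) (H_skew hc) (HG hc).
by rewrite gNl !opprK addNr.
Qed.

(** The trace of X |-> (nabla_X G) Y is computed by splitting X into its horizontal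
    part and its components along U and V; since the frame is arbitrary, the
    splitting is written as a sum of rank one operators. *)
Lemma ric_hor_U Y : hor U V Y -> ric E Y U = 0.
Proof.
move=> hY; rewrite ric_U (dsigma2_V_hor hY) addr0.
suff -> : \sum_a g (cov G (E a) Y) (E a) = sg (H Y) by rewrite addNr.
(* the horizontal projection *)
pose P X := - G (G X).
have Pl a A B : P (a *: A + B) = a *: P A + P B.
  by rewrite /P !(G_linear hc) opprD scalerN.
have PH : P (H Y) = H Y by rewrite /P (GG_hor hc (hor_H hc Y)) opprK.
have PU : P U = 0 by rewrite /P (GU hc) (G0 hc) oppr0.
have PV : P V = 0 by rewrite /P (GV hc) (G0 hc) oppr0.
have hP X : hor U V (P X).
  by rewrite /P -(GN hc); exact: (hor_G hc).
have covl := cov_linear (G_linear hc) Y.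
have cov0 : cov G 0 Y = 0 by rewrite /cov !D_0l (G0 hc) subr0.
have cUU : g (cov G U Y) U = 0.
  rewrite (g_sym lc) (cov_G_skew hc) /cov (GU hc) D_0r (D_U_U hc) (GZ hc) (GV hc).
  by rewrite scaler0 subr0 g0l oppr0.
have cVV : g (cov G V Y) V = 0.
  rewrite (g_sym lc) (cov_G_skew hc) /cov (GV hc) D_0r (D_V hc) (HV hc) oppr0.
  by rewrite !add0r (GN hc) (GZ hc) (GU hc) scaler0 !oppr0 g0l oppr0.
transitivity (\sum_a (sg (P (E a)) * g (H Y) (E a)
    + g (cov G (P (E a)) Y) U * g U (E a)
    + g (cov G (P (E a)) Y) V * g V (E a)
    + g (cov G U Y) (E a) * g U (E a) + g (cov G V Y) (E a) * g V (E a))).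
  apply: eq_bigr => a _; move: (E a) => X.
  have dX : X = g U X *: U + (g V X *: V + P X).
    by rewrite [LHS](hor_dec hc) /P -addrA addrC addrA.
  have c1 : g (cov G X Y) X = g U X * g (cov G U Y) X
      + (g V X * g (cov G V Y) X + g (cov G (P X) Y) X).
    by rewrite {1}dX !covl !(g_linear lc).
  have c2 : g (cov G (P X) Y) (P X) = sg (P X) * g (H Y) X.
    rewrite (g_sym lc) (cov_G_hor (hP X) (hP X) hY); congr (_ * _).
    rewrite {1}/P gNl -(G_skew hc) -[LHS]opprK -(G_skew hc) -gNr -/(P _) PH.
    by rewrite (g_sym lc).
  have c3 : g (cov G (P X) Y) X = g U X * g (cov G (P X) Y) U
      + (g V X * g (cov G (P X) Y) V + g (cov G (P X) Y) (P X)).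
    by rewrite {2}dX !gDr !gZr.
  by rewrite c1 c3 c2; ring.
rewrite !big_split /= (@trace_rank_one (fun X => sg (P X))); last first.
  by move=> a A B; rewrite Pl sigmaD sigmaZ.
rewrite (@trace_rank_one (fun X => g (cov G (P X) Y) U)); last first.
  by move=> a A B; rewrite Pl covl gDl gZl.
rewrite (@trace_rank_one (fun X => g (cov G (P X) Y) V)); last first.
  by move=> a A B; rewrite Pl covl gDl gZl.
rewrite (@trace_rank_one (fun X => g (cov G U Y) X)); last first.
  by move=> a A B; rewrite gDr gZr.
rewrite (@trace_rank_one (fun X => g (cov G V Y) X)); last first.
  by move=> a A B; rewrite gDr gZr.
by rewrite PH PU PV cov0 !g0l cUU cVV !addr0.
Qed.

End Ricci.
End RicciAlongU.
Section RicciAlongVertical.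
Variables (U V : L) (G H : L -> L).
Hypothesis hc : contact_calculus U V G H.
Local Notation sg := (sigma U V).
Local Notation ds := (dsigma2 U V).
Variables (N : nat) (E : 'I_N -> L).
Hypothesis E_on : forall a b, g (E a) (E b) = (a == b)%:R.
Hypothesis E_span : forall X, X = \sum_a g X (E a) *: E a.

Theorem ricci_vertical :
  (forall Y, hor U V Y -> ric E Y U = 0 /\ ric E Y V = 0) /\
  [/\ ric E U U = N%:R - 2 - ds U V, ric E V V = N%:R - 2 - ds U V
     & ric E U V = 0].
Proof.
have hr := contact_rotated hc.
have ricNl X Y : ric E (- X) Y = - ric E X Y.
  rewrite /ric -sumrN; apply: eq_bigr => a _; rewrite -gNl; congr (g _ _).
  rewrite /curv /br !(D_oppl, D_oppr) -[LHS]opprK; congr (- _).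
  by rewrite -!opprD !D_oppl !opprK.
split=> [Y hY|].
  split; first exact: (ric_hor_U hc E_span).
  apply: (ric_hor_U hr E_span); case: hY => uY vY; split => //.
  by rewrite gNl uY oppr0.
split; first exact: (ric_U_U hc E_on E_span).
  rewrite (ric_U_U hr E_on E_span) (dsigma2_rotated hc); congr (_ - _).
  rewrite (dsigma2_antisym U V V); have := dsigma2_linear U V V (-1) U (- U).
  have := dsigma2_linear U V V (-1) 0 0; rewrite scaler0 addr0 mulN1r addNr => ds0.
  have := dsigma2_linear U V V 1 U (- U); rewrite scale1r subrr ds0 mul1r => e _.
  by apply: (eq_from e); ring.
apply: oppr_inj; rewrite -ricNl oppr0; exact: (ric_V_U hr E_span).
Qed.
End RicciAlongVertical.

End Calculus.

(** * The ring of smooth functions and the module of smooth fields *)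

Section Ck.
Variables (R : realType) (V : normedModType R).
Implicit Types (f g : V -> R) (O : set V).

(** Openness matters: derivatives at a point of O only depend on values in O. *)
Lemma Ck_ext k O f g : open O -> (forall x, O x -> f x = g x) ->
  Ck k O f -> Ck k O g.
Proof.
move=> oO; elim: k f g => [|k IH] f g fg.
  move=> Cf x Ox; have fx := Cf x Ox; rewrite /prop_for /continuous_at -(fg x Ox).
  apply: cvg_trans fx; apply: near_eq_cvg.
  by apply: filterS (open_nbhs_nbhs (conj oO Ox)) => y /fg.
have nfg x : O x -> {near x, f =1 g}.
  by move=> Ox; apply: filterS (open_nbhs_nbhs (conj oO Ox)) => y /fg.
move=> [df Cf]; split => [x v Ox|v].
  by apply: (near_eq_derivable (nfg x Ox)); exact: df.
by apply: IH (Cf v) => x Ox; apply: near_eq_derive; exact: nfg.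
Qed.

Lemma Cinfty_ext O f g : open O -> (forall x, O x -> f x = g x) ->
  Cinfty O f -> Cinfty O g.
Proof. by move=> oO fg Cf k; apply: Ck_ext (Cf k). Qed.

Lemma CkS k O O' f : O' `<=` O -> Ck k O f -> Ck k O' f.
Proof.
move=> OO; elim: k f => [|k IH] f; first by move=> Cf x /OO; exact: Cf.
move=> [df Cf]; split => [x v /OO Ox|v]; [exact: df|exact: IH (Cf v)].
Qed.

Lemma Cinfty_derivable O f x v : Cinfty O f -> O x -> derivable f x v.
Proof. by move=> /(_ 1%N) [df _]; exact: df. Qed.

Lemma Cinfty_derive O f v : Cinfty O f -> Cinfty O ('D_v f).
Proof. by move=> Cf k; have [_] := Cf k.+1; exact. Qed.

Lemma Cinfty_cst O (a : R) : Cinfty O (cst a).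
Proof.
move=> k; elim: k a => [|k IH] a; first by move=> x _; exact: cst_continuous.
split => [x v _|v]; first exact: derivable_cst.
rewrite (_ : 'D_v _ = cst 0); first exact: IH.
by apply/funext => x; rewrite derive_cst.
Qed.

Lemma CkD k O f g : open O -> Ck k O f -> Ck k O g -> Ck k O (f + g).
Proof.
move=> oO; elim: k f g => [|k IH] f g.
  by move=> Cf Cg x Ox; apply: continuousD; [exact: Cf|exact: Cg].
move=> [df Cf] [dg Cg]; split => [x v Ox|v].
  by apply: derivableD; [exact: df|exact: dg].
apply: (@Ck_ext k O ('D_v f + 'D_v g)) => // [x Ox|]; last exact: IH (Cf v) (Cg v).
by rewrite deriveD//; [exact: df|exact: dg].
Qed.

Lemma CinftyD O f g : open O -> Cinfty O f -> Cinfty O g -> Cinfty O (f + g).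
Proof. by move=> oO Cf Cg k; exact: CkD. Qed.

(** The induction runs over all pairs of smooth functions at once, since the Leibniz
    rule produces products with derivatives whose order of smoothness has to stay
    unbounded. *)
Lemma CinftyM O f g : open O -> Cinfty O f -> Cinfty O g -> Cinfty O (f * g).
Proof.
move=> oO Cf Cg k; elim: k f g Cf Cg => [|k IH] f g Cf Cg.
  by move=> x Ox; apply: continuousM; [exact: (Cf 0%N)|exact: (Cg 0%N)].
split => [x v Ox|v].
  by apply: derivableM; [exact: Cinfty_derivable Cf _|exact: Cinfty_derivable Cg _].
apply: (@Ck_ext k O (f * 'D_v g + g * 'D_v f)) => // [x Ox|].
  by rewrite deriveM//; [exact: Cinfty_derivable Cf _|exact: Cinfty_derivable Cg _].
by apply: CkD => //; apply: IH => //; exact: Cinfty_derive.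
Qed.
End Ck.

Section Charts.
Variables (R : realType) (m : nat).

Lemma cplx_continuous : continuous (@cplx R m).
Proof.
move=> x A /nbhs_ballP [e /= e0 eA].
have [r r0 er] : exists2 r : R, 0 < r & e = (r%:C)%C.
  case: e e0 {eA} => a b; rewrite ltcE /= => /andP[/eqP -> a0].
  by exists a.
have r2 : 0 < r / 2 by rewrite divr_gt0.
apply/nbhs_ballP; exists (r / 2) => //= y [_ xy]; apply: eA; split=> // i k.
have := xy i (lshift m k); have := xy i (rshift m k).
rewrite !ord1 !mxE /ball /= er => xr xl.
rewrite normc_def ltcR /= -[ltRHS](gtr0_norm r0) -sqrtr_sqr ltr_sqrt; last first.
  by rewrite exprn_gt0.
move: xr xl; set a := _ - _; set b := _ - _.
by move=> /ltr_normlP[a1 a2] /ltr_normlP[b1 b2]; nra.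
Qed.

(** The coordinate image is the part of the range of the chart where the inverse
    chart lands in W, hence open by continuity of the inverse. *)
Lemma open_crange (M : topologicalType) (c : chart R m M) (W : set M) :
  is_chart c -> open W -> open (crange c W).
Proof.
move=> [[oc or] cK _ cinvC] oW.
have -> : crange c W = crange c setT `&` cinv c @^-1` W.
  apply/seteqP; split => [z [p [cp Wp] <-]|z [[p [cp _] <-]]] /=.
    by split; [exists p|rewrite /= cK].
  by rewrite cK// => Wp; exists p.
rewrite openE => z [rz Wz]; apply: filterI.
  exact: open_nbhs_nbhs (conj or rz).
by apply: (cinvC z rz); exact: open_nbhs_nbhs (conj oW Wz).
Qed.

Lemma open_real_range (M : topologicalType) (c : chart R m M) (W : set M) :
  is_chart c -> open W -> open [set x | crange c W (cplx x)].
Proof.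
move=> cc oW; apply: (@open_comp _ _ _ (crange c W)) => [x _|].
  exact: cplx_continuous.
exact: open_crange.
Qed.
End Charts.

Section Smooth.
Variables (R : realType) (m : nat) (M : complexManifold R m).
Implicit Types (W : set M) (f h : M -> R) (X Y : vfield M).

Lemma smooth_on_ext W f h : open W -> (forall q, W q -> f q = h q) ->
  smooth_on W f -> smooth_on W h.
Proof.
move=> oW fh sf c ac; apply: Cinfty_ext (sf c ac).
  exact: open_real_range (atlas_chart ac) oW.
move=> x /= [q [cq Wq] <-].
by have [_ cK _ _] := atlas_chart ac; rewrite cK//; exact: fh.
Qed.

Lemma smooth_onS W W' f : W' `<=` W -> smooth_on W f -> smooth_on W' f.
Proof.
move=> WW sf c ac k; apply: CkS (sf c ac k) => x /= [q [cq Wq] e].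
by exists q => //; split=> //; exact: WW.
Qed.

Lemma smooth_on_cst W (a : R) : smooth_on W (cst a).
Proof. by move=> c _; exact: Cinfty_cst. Qed.

Lemma smooth_onD W f h : open W -> smooth_on W f -> smooth_on W h ->
  smooth_on W (fun q => f q + h q).
Proof.
move=> oW sf sh c ac; apply: CinftyD (sf c ac) (sh c ac).
exact: open_real_range (atlas_chart ac) oW.
Qed.

Lemma smooth_onM W f h : open W -> smooth_on W f -> smooth_on W h ->
  smooth_on W (fun q => f q * h q).
Proof.
move=> oW sf sh c ac; apply: CinftyM (sf c ac) (sh c ac).
exact: open_real_range (atlas_chart ac) oW.
Qed.

Lemma smooth_on_at W f p : open W -> W p -> smooth_on W f -> smooth_at p f.
Proof. by move=> oW Wp sf; exists W. Qed.

Lemma tangent_linear p (a : R) (x y : tvec M) : is_tangent p x ->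
  is_tangent p y -> is_tangent p (a *: x + y).
Proof.
move=> [x1 x2 x3 x4] [y1 y2 y3 y4].
have E f : (a *: x + y) f = a * x f + y f by [].
split=> [b f h sf sh|f h sf sh|f h sf sh fh|f nf]; rewrite !E.
- by rewrite x1// y1//; ring.
- by rewrite x2// y2//; ring.
- by rewrite (x3 f h)// (y3 f h).
- by rewrite x4// y4//; ring.
Qed.

Lemma tangent0 p : is_tangent p (0 : tvec M).
Proof.
have E f : (0 : tvec M) f = 0 by [].
by split=> [b f h sf sh|f h sf sh|f h sf sh fh|f nf]; rewrite !E//; ring.
Qed.

Lemma smooth_vfield_ext W X Y : open W -> (forall q, W q -> X q = Y q) ->
  smooth_vfield W X -> smooth_vfield W Y.
Proof.
move=> oW XY [tX sX]; split=> [q Wq|W' f oW' W'W sf].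
  by rewrite -XY//; exact: tX.
apply: smooth_on_ext (sX W' f oW' W'W sf) => // q W'q.
by rewrite XY//; exact: W'W.
Qed.

Lemma smooth_vfield_linear W f X Y : open W -> smooth_on W f ->
  smooth_vfield W X -> smooth_vfield W Y ->
  smooth_vfield W (fun q => f q *: X q + Y q).
Proof.
move=> oW sf [tX sX] [tY sY]; split=> [q Wq|W' h oW' W'W sh].
  by apply: tangent_linear; [exact: tX|exact: tY].
apply: (@smooth_on_ext W' (fun q => f q * X q h + Y q h)) => //.
apply: smooth_onD => //; last exact: sY.
by apply: smooth_onM => //; [exact: smooth_onS sf|exact: sX].
Qed.

Lemma smooth_vfield0 W : smooth_vfield W (fun _ => 0).
Proof.
split=> [q Wq|W' h oW' W'W sh]; first exact: tangent0.
exact: smooth_on_cst.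
Qed.

Lemma smooth_vfieldS (O O' : set M) X : O' `<=` O ->
  smooth_vfield O X -> smooth_vfield O' X.
Proof.
move=> OO [tX sX]; split=> [q /OO|W' f oW' W'O sf]; first exact: tX.
by apply: sX => // q /W'O /OO.
Qed.

End Smooth.

(** Open sets are bundled with their openness proof, so that the ring and module
    structures below can be inferred from the open set. *)
Record opens (T : topologicalType) := Opens {
  oset :> set T; osetP : open oset }.

Section Extension.
Variables (T : Type) (W : set T) (V : zmodType).
(** Functions and fields on an open set are functions on its points, which makes
    equality on the open set an actual equality; derivations and connections act
    on total functions, to which [ext] returns by the value 0. *)
Definition ext (f : {q | W q} -> V) : T -> V :=
  fun q => if pselect (W q) is left w then f (exist _ q w) else 0.
Definition res (f : T -> V) : {q | W q} -> V := fun q => f (sval q).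
Lemma extE f (q : {q | W q}) : ext f (sval q) = f q.
Proof.
rewrite /ext; case: q => q Wq /=; case: pselect => // w.
by congr f; congr exist; exact: Prop_irrelevance.
Qed.
Lemma ext_res (f : T -> V) q : W q -> ext (res f) q = f q.
Proof. by move=> Wq; rewrite -[q]/(sval (exist W q Wq)) extE. Qed.
Lemma ext_add f g : ext (f + g) = (fun q => ext f q + ext g q).
Proof.
by apply/funext => q; rewrite /ext; case: pselect => // _; rewrite addr0.
Qed.
Lemma ext_opp f : ext (- f) = (fun q => - ext f q).
Proof.
by apply/funext => q; rewrite /ext; case: pselect => // _; rewrite oppr0.
Qed.
End Extension.

Definition pts (T : topologicalType) (W : opens T) := {q | oset W q}.

Section SmoothAlgebra.
Variables (R : realType) (m : nat) (M : complexManifold R m) (W : opens M).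

Definition smooth_fun : {pred ((pts W) -> R)} :=
  fun f => `[< smooth_on W (ext f) >].

Lemma smooth_funP (f : (pts W) -> R) :
  reflect (smooth_on W (ext f)) (f \in smooth_fun).
Proof. exact: asboolP. Qed.

Fact smooth_fun_subring : subring_closed (smooth_fun).
Proof.
have oW := osetP W.
have sM f h : f \in smooth_fun -> h \in smooth_fun -> f * h \in smooth_fun.
  move=> /smooth_funP sf /smooth_funP sh; apply/smooth_funP.
  apply: (@smooth_on_ext _ _ _ W (fun q => ext f q * ext h q)) => //.
    by move=> q Wq; rewrite -[q]/(sval (exist (oset W) q Wq)) !extE.
  exact: smooth_onM.
have sN f : f \in smooth_fun -> - f \in smooth_fun.
  move=> /smooth_funP sf; apply/smooth_funP; rewrite ext_opp.
  apply: (@smooth_on_ext _ _ _ W (fun q => cst (-1) q * ext f q)) => //.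
    by move=> q Wq; rewrite /= mulN1r.
  by apply: smooth_onM => //; exact: smooth_on_cst.
split=> // [|f h sf /sN].
  apply/smooth_funP; apply: (@smooth_on_ext _ _ _ W (cst 1)) => //.
    by move=> q Wq; rewrite -[q in RHS]/(sval (exist (oset W) q Wq)) extE.
  exact: smooth_on_cst.
move: sf => /smooth_funP sf /smooth_funP sh; apply/smooth_funP.
by rewrite ext_add; exact: smooth_onD.
Qed.
HB.instance Definition _ := GRing.isSubringClosed.Build _ (smooth_fun)
  smooth_fun_subring.

Record sfun := SFun {
  sfun_val :> (pts W) -> R;
  sfunP : sfun_val \in smooth_fun }.
HB.instance Definition _ := [isSub for sfun_val].
HB.instance Definition _ := [Choice of sfun by <:].
HB.instance Definition _ := GRing.SubChoice_isSubComPzRing.Build _ smooth_fun sfun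
  smooth_fun_subring.

Definition smooth_field : {pred ((pts W) -> tvec M)} :=
  fun X => `[< smooth_vfield W (ext X) >].

Lemma smooth_fieldP (X : (pts W) -> tvec M) :
  reflect (smooth_vfield W (ext X)) (X \in smooth_field).
Proof. exact: asboolP. Qed.

Fact smooth_field_linear (f : (pts W) -> R)
    (X Y : (pts W) -> tvec M) : f \in smooth_fun -> X \in smooth_field ->
  Y \in smooth_field -> (fun q => f q *: X q) + Y \in smooth_field.
Proof.
move=> /smooth_funP sf /smooth_fieldP sX /smooth_fieldP sY; apply/smooth_fieldP.
apply: smooth_vfield_ext (smooth_vfield_linear (osetP W) sf sX sY).
  exact: osetP.
by move=> q Wq; rewrite -[q]/(sval (exist (oset W) q Wq)) !extE.
Qed.

Fact smooth_field0 : 0 \in smooth_field.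
Proof.
apply/smooth_fieldP; apply: smooth_vfield_ext (smooth_vfield0 W).
  exact: osetP.
by move=> q Wq; rewrite -[q in RHS]/(sval (exist (oset W) q Wq)) !extE.
Qed.

Fact smooth_field_zmod : zmod_closed (smooth_field).
Proof.
split=> [|X Y sX sY]; first exact: smooth_field0.
have -> : X - Y = (fun q => (-1 : (pts W) -> R) q *: Y q) + X.
  by apply/funext => q; rewrite addrC /= [X in _ = X + _]scaleN1r.
by apply: smooth_field_linear => //; exact: (rpredN1 (smooth_fun)).
Qed.

Record sfield := SField {
  sfield_val :> (pts W) -> tvec M;
  sfieldP : sfield_val \in smooth_field }.
HB.instance Definition _ := [isSub for sfield_val].
HB.instance Definition _ := [Choice of sfield by <:].
HB.instance Definition _ := GRing.SubChoice_isSubZmodule.Build _ smooth_field sfield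
  smooth_field_zmod.

Fact sscale_subproof (f : sfun) (X : sfield) :
  (fun q => f q *: X q) \in smooth_field.
Proof.
rewrite -[X in X \in _]addr0; apply: smooth_field_linear.
- exact: sfunP.
- exact: sfieldP.
- exact: smooth_field0.
Qed.
Definition sscale f X := SField (sscale_subproof f X).

Lemma sfun_eq (f h : sfun) : (forall q, f q = h q) -> f = h.
Proof. by move=> fh; apply/val_inj/funext. Qed.
Lemma sfield_eq (X Y : sfield) : (forall q, X q = Y q) -> X = Y.
Proof. by move=> XY; apply/val_inj/funext. Qed.
Lemma sfunDE (f h : sfun) q : (f + h) q = f q + h q. Proof. by []. Qed.
Lemma sfunNE (f : sfun) q : (- f) q = - f q. Proof. by []. Qed.
Lemma sfunME (f h : sfun) q : (f * h) q = f q * h q. Proof. by []. Qed.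
Lemma sfun0E q : (0 : sfun) q = 0. Proof. by []. Qed.
Lemma sfun1E q : (1 : sfun) q = 1. Proof. by []. Qed.
Lemma sfieldDE (X Y : sfield) q : (X + Y) q = X q + Y q. Proof. by []. Qed.
Lemma sfieldNE (X : sfield) q : (- X) q = - X q. Proof. by []. Qed.
Lemma sfield0E q : (0 : sfield) q = 0. Proof. by []. Qed.

Lemma sfield_add3_eq0 (X Y Z : sfield) :
  (forall q f, X q f + Y q f + Z q f = 0) -> X + Y + Z = 0.
Proof. by move=> e; apply: sfield_eq => q; apply/funext => f; exact: e. Qed.

Program Definition sfield_lmod :=
  @GRing.Zmodule_isLmodule.Build sfun sfield sscale _ _ _ _.
Next Obligation. by move=> *; apply: sfield_eq => q /=; rewrite scalerA. Qed.
Next Obligation. by move=> *; apply: sfield_eq => q /=; rewrite scale1r. Qed.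
Next Obligation. by move=> *; apply: sfield_eq => q; rewrite /= scalerDr. Qed.
Next Obligation. by move=> X f h; apply: sfield_eq => q; rewrite /= scalerDl. Qed.
HB.instance Definition _ := sfield_lmod.
Lemma sfieldZE (f : sfun) (X : sfield) q : (f *: X) q = f q *: X q.
Proof. by []. Qed.
Lemma sfun_sum N (f : 'I_N -> sfun) q : (\sum_a f a) q = \sum_a f a q.
Proof. by elim/big_rec2: _ => // a s t _ <-. Qed.
Lemma sfun_natr k q : (k%:R : sfun) q = k%:R.
Proof. by elim: k => // k IH; rewrite !mulrS sfunDE IH. Qed.
Lemma sfield_sum N (f : 'I_N -> sfield) q : (\sum_a f a) q = \sum_a f a q.
Proof. by elim/big_rec2: _ => // a s t _ <-. Qed.

End SmoothAlgebra.
(** * Vector calculus on an open set of a complex manifold *)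

Section Bridge.
Variables (R : realType) (m : nat) (M : complexManifold R m) (W : opens M).
Local Notation F := (sfun W).
Local Notation L := (sfield W).
Implicit Types (X Y Z : L) (f : F).

Lemma ext_smooth_fun f : smooth_on W (ext f).
Proof. exact/smooth_funP/sfunP. Qed.
Lemma ext_smooth_field X : smooth_vfield W (ext X).
Proof. exact/smooth_fieldP/sfieldP. Qed.
Lemma ext_tangent X q : is_tangent (sval q) (X q).
Proof. by rewrite -extE; apply: (ext_smooth_field X).1; case: q. Qed.

Fact mk_sfun_subproof (f : M -> R) : smooth_on W f ->
  (res f : pts W -> R) \in @smooth_fun _ _ _ W.
Proof.
move=> sf; apply/smooth_funP; apply: smooth_on_ext sf; first exact: osetP.
by move=> q Wq; rewrite ext_res.
Qed.
Definition mk_sfun (f : M -> R) sf : F := SFun (@mk_sfun_subproof f sf).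

Fact mk_sfield_subproof (X : vfield M) : smooth_vfield W X ->
  (res X : pts W -> tvec M) \in @smooth_field _ _ _ W.
Proof.
move=> sX; apply/smooth_fieldP; apply: smooth_vfield_ext sX; first exact: osetP.
by move=> q Wq; rewrite ext_res.
Qed.
Definition mk_sfield (X : vfield M) sX : L := SField (@mk_sfield_subproof X sX).

(** Tangent vectors act on germs. *)
Lemma tangent_local p (x : tvec M) (W' : set M) (f k : M -> R) :
  is_tangent p x -> open W' -> W' p ->
  smooth_on W' f -> (forall r, W' r -> f r = k r) -> x f = x k.
Proof.
move=> [_ _ xl _] oW' W'p sf fk; apply: xl.
- by exists W'.
- by exists W'; split=> //; exact: smooth_on_ext sf.
- by apply: filterS (open_nbhs_nbhs (conj oW' W'p)) => q /fk.
Qed.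

Fact sder_subproof X f : smooth_on W (fun q => ext X q (ext f)).
Proof.
by apply: (ext_smooth_field X).2; [exact: osetP| |exact: ext_smooth_fun].
Qed.
Definition sder X f : F := mk_sfun (sder_subproof X f).
Lemma sderE X f q : sder X f q = X q (ext f).
Proof. by rewrite /= /res extE. Qed.

(** [X'] is any total field that coincides with [X] on W; a notion is needed because
    the given fields are arbitrary outside W. *)
Definition extends (X : L) (X' : vfield M) :=
  smooth_vfield W X' /\ forall q, X q = X' (sval q).

Lemma extends_ext X : extends X (ext X).
Proof. by split=> [|q]; [exact: ext_smooth_field|rewrite extE]. Qed.
Section Metric.
Variables (g : M -> tvec M -> tvec M -> R) (hg : riemannian g).
Fact smetric_subproof X Y : smooth_on W (fun q => g q (ext X q) (ext Y q)).
Proof.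
by have [_ _ _] := hg; apply; [exact: osetP|exact: ext_smooth_field..].
Qed.
Definition smetric X Y : F := mk_sfun (smetric_subproof X Y).
Lemma smetricE X Y q : smetric X Y q = g (sval q) (X q) (Y q).
Proof. by rewrite /= /res !extE. Qed.

Variables (D : M -> tvec M -> vfield M -> tvec M) (hD : levi_civita g D).
Let cD := lc_conn hD.

Fact sconn_subproof X Y : smooth_vfield W (fun q => D q (ext X q) (ext Y)).
Proof.
by apply: (conn_smooth cD); [exact: osetP|exact: ext_smooth_field..].
Qed.
Definition sconn X Y : L := mk_sfield (sconn_subproof X Y).
Lemma sconnE X (Y : L) (Y' : vfield M) q : smooth_vfield W Y' ->
  (forall r, Y r = Y' (sval r)) -> sconn X Y q = D (sval q) (X q) Y'.
Proof.
move=> sY' YY'; rewrite /= /res !extE.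
apply: (conn_local cD (osetP W)) => //; first by case: q.
- exact: ext_tangent.
- exact: ext_smooth_field.
- by move=> r Wr; rewrite -[r]/(sval (exist (oset W) r Wr)) extE YY'.
Qed.
Lemma sconnE0 X Y q : sconn X Y q = D (sval q) (X q) (ext Y).
Proof. by apply: sconnE; [exact: ext_smooth_field|move=> r; rewrite extE]. Qed.

Lemma sbrE X Y (X' Y' : vfield M) q :
  smooth_vfield W X' -> (forall r, X r = X' (sval r)) ->
  smooth_vfield W Y' -> (forall r, Y r = Y' (sval r)) ->
  br sconn X Y q = bracket X' Y' (sval q).
Proof.
move=> sX XX' sY YY'; rewrite -(lc_torsion hD (osetP W)) //; last by case: q.
by rewrite /br sfieldDE sfieldNE (sconnE _ _ sY YY') (sconnE _ _ sX XX') XX' YY'.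
Qed.

Lemma ext_mul (f k : F) : ext (f * k) = (fun q => ext f q * ext k q).
Proof.
by apply/funext => q; rewrite /ext; case: pselect => // _; rewrite mulr0.
Qed.

Lemma sval_in (q : pts W) : oset W (sval q). Proof. by case: q. Qed.

Lemma smooth_at_ext f (q : pts W) : smooth_at (sval q) (ext f).
Proof.
exact: smooth_on_at (osetP W) (sval_in q) (ext_smooth_fun f).
Qed.

Lemma sder_br X Y f :
  sder (br sconn X Y) f = sder X (sder Y f) - sder Y (sder X f).
Proof.
apply: sfun_eq => q; rewrite sfunDE sfunNE !sderE.
have E (Z : L) : (forall r, Z r = ext Z (sval r)) by move=> r; rewrite extE.
rewrite (sbrE q (ext_smooth_field X) (E X) (ext_smooth_field Y) (E Y)).
rewrite /bracket asboolT; last exact: smooth_at_ext.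
rewrite !extE; congr (_ - _).
  apply: tangent_local (ext_tangent X q) (osetP W) (sval_in q) (sder_subproof Y f) _.
  by move=> r Wr; rewrite -[r]/(sval (exist (oset W) r Wr)) !extE sderE.
apply: tangent_local (ext_tangent Y q) (osetP W) (sval_in q) (sder_subproof X f) _.
by move=> r Wr; rewrite -[r]/(sval (exist (oset W) r Wr)) !extE sderE.
Qed.

(** Tangent vectors are determined by their values on functions that are smooth
    only near the point, so the identity is tested on those; on a smaller open set
    all brackets unfold to iterated derivatives, which cancel. *)
Lemma sjacobi X Y Z : br sconn (br sconn X Y) Z + br sconn (br sconn Y Z) X
  + br sconn (br sconn Z X) Y = 0.
Proof.
apply: sfield_add3_eq0 => q f.
have E (A : L) : (forall r, A r = ext A (sval r)) by move=> r; rewrite extE.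
case: (pselect (smooth_at (sval q) f)) => [|nf]; last first.
  have t0 (A : L) : A q f = 0 by have [_ _ _ ->] := ext_tangent A q.
  by rewrite !t0 !addr0.
move=> [W' [oW' W'q sf]].
pose W0 := oset W `&` W'.
have oW0 : open W0 by apply: openI => //; exact: osetP.
have W0q : W0 (sval q) by split=> //; exact: sval_in.
have {}sf : smooth_on W0 f by apply: smooth_onS sf => r [].
pose d (A : L) (k : M -> R) := fun r => ext A r k.
have sd A k : smooth_on W0 k -> smooth_on W0 (d A k).
  by move=> sk; apply: (ext_smooth_field A).2 => // r [].
have brE A B k r : smooth_on W0 k -> W0 r ->
    ext (br sconn A B) r k = d A (d B k) r - d B (d A k) r.
  move=> sk W0r; have [Wr _] := W0r.
  rewrite -[X in ext _ X]/(sval (exist (oset W) r Wr)) extE.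
  rewrite (sbrE _ (ext_smooth_field A) (E A) (ext_smooth_field B) (E B)).
  by rewrite /bracket asboolT //=; exists W0.
have brbr A B C : br sconn (br sconn A B) C q f
    = d A (d B (d C f)) (sval q) - d B (d A (d C f)) (sval q)
      - (d C (d A (d B f)) (sval q) - d C (d B (d A f)) (sval q)).
  rewrite -extE brE // {1}/d brE; [|exact: sd|by []]; congr (_ - _).
  rewrite /d extE.
  have tC := ext_tangent C q; have [tlin _ _ _] := tC.
  transitivity (C q (fun r => -1 * d B (d A f) r + d A (d B f) r)).
    symmetry; apply: (tangent_local tC oW0 W0q).
      apply: (smooth_onD oW0); last exact: sd (sd _ _ sf).
      apply: (smooth_onM oW0); last exact: sd (sd _ _ sf).
      exact: (@smooth_on_cst _ _ _ W0 (-1)).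
    by move=> r W0r; rewrite brE// mulN1r addrC.
  rewrite tlin; last 2 first.
  - by apply: (smooth_on_at oW0 W0q); apply/sd/sd.
  - by apply: (smooth_on_at oW0 W0q); apply/sd/sd.
  by rewrite mulN1r addrC.
rewrite !brbr; ring.
Qed.

(** Each axiom is the corresponding pointwise axiom, applied to extensions by zero. *)
Lemma smooth_lc_calculus : lc_calculus sder smetric sconn.
Proof.
have [g1 g2 g3 _] := hg; split.
- move=> f /(congr1 (fun k : F => k : pts W -> R)) f0; apply: sfun_eq => q.
  by have := congr1 (@^~ q) f0; rewrite sfunDE sfun0E; lra.
- move=> X f k; apply: sfun_eq => q; rewrite sfunDE !sderE ext_add.
  have [tl _ _ _] := ext_tangent X q.
  have := tl 1 _ _ (smooth_at_ext f q) (smooth_at_ext k q); rewrite mul1r => <-.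
  by congr (X q _); apply/funext => r; rewrite mul1r.
- move=> X f k; apply: sfun_eq => q; rewrite sfunDE !sfunME !sderE ext_mul.
  have [_ tM _ _] := ext_tangent X q.
  by rewrite (tM _ _ (smooth_at_ext f q) (smooth_at_ext k q)) !extE.
- by move=> a X Y f; apply: sfun_eq => q; rewrite sfunDE sfunME !sderE.
- move=> X Y; apply: sfun_eq => q; rewrite !smetricE.
  by apply: g2; exact: ext_tangent.
- move=> a X Y Z; apply: sfun_eq => q; rewrite sfunDE sfunME !smetricE.
  by rewrite sfieldDE sfieldZE g1//; exact: ext_tangent.
- move=> X gX; apply: sfield_eq => q; rewrite sfield0E.
  apply/not_notP => X0; have := g3 _ _ (ext_tangent X q) X0.
  by rewrite -smetricE gX sfun0E ltxx.
- move=> a X Y Z; apply: sfield_eq => q; rewrite sfieldDE !sfieldZE !sconnE0.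
  rewrite sfieldDE sfieldZE; apply: (conn_linear cD (a q) (osetP W)).
  + exact: sval_in.
  + exact: ext_tangent.
  + exact: ext_tangent.
  + exact: ext_smooth_field.
- move=> X Y Z; apply: sfield_eq => q; rewrite sfieldDE !sconnE0 ext_add.
  apply: (conn_add cD (osetP W)); first exact: sval_in.
  + exact: ext_tangent.
  + exact: ext_smooth_field.
  + exact: ext_smooth_field.
- move=> X a Y; apply: sfield_eq => q; rewrite sfieldDE !sfieldZE !sconnE0 sderE.
  have -> : ext (a *: Y) = (fun r => ext a r *: ext Y r).
    by apply/funext => r; rewrite /ext; case: pselect => // _; rewrite scaler0.
  rewrite (conn_leibniz cD (osetP W)) ?extE//.
  + exact: sval_in.
  + exact: ext_tangent.
  + exact: ext_smooth_fun.
  + exact: ext_smooth_field.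
- move=> X Y Z; apply: sfun_eq => q; rewrite sfunDE sderE !smetricE !sconnE0.
  rewrite -[in Y q]extE -[in Z q]extE.
  rewrite -(lc_metric hD (osetP W) (sval_in q) (ext_tangent X q)
    (ext_smooth_field Y) (ext_smooth_field Z)).
  apply: esym; apply: tangent_local (ext_tangent X q) (osetP W) (sval_in q) _ _.
    exact: smetric_subproof.
  by move=> r Wr; rewrite -[r]/(sval (exist (oset W) r Wr)) !extE smetricE.
- exact: sder_br.
- exact: sjacobi.
Qed.
End Metric.
End Bridge.

(** * Pointwise algebra of the almost contact structure *)

Section RiemannianPointwise.
Variables (R : realType) (m : nat) (M : complexManifold R m).
Variables (g : M -> tvec M -> tvec M -> R) (hg : riemannian g) (p : M).

Lemma metric_sym x y : is_tangent p x -> is_tangent p y -> g p x y = g p y x.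
Proof. by case: hg => _ + _ _; exact. Qed.

Lemma metric_linear (a : R) x y z : is_tangent p x -> is_tangent p y ->
  is_tangent p z -> g p (a *: x + y) z = a * g p x z + g p y z.
Proof. by case: hg => + _ _ _; exact. Qed.

Lemma metric0l z : is_tangent p z -> g p 0 z = 0.
Proof.
move=> tz; have := metric_linear 1 (tangent0 p) (tangent0 p) tz.
by rewrite scale1r addr0; lra.
Qed.

Lemma metricD x y z : is_tangent p x -> is_tangent p y -> is_tangent p z ->
  g p (x + y) z = g p x z + g p y z.
Proof. by move=> tx ty tz; rewrite -[x]scale1r metric_linear// mul1r scale1r. Qed.

Lemma metricZ (a : R) x z : is_tangent p x -> is_tangent p z ->
  g p (a *: x) z = a * g p x z.
Proof.
by move=> tx tz; rewrite -[a *: x]addr0 metric_linear ?metric0l ?addr0//;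
  exact: tangent0.
Qed.

Lemma metricN x z : is_tangent p x -> is_tangent p z -> g p (- x) z = - g p x z.
Proof. by move=> tx tz; rewrite -scaleN1r metricZ// mulN1r. Qed.

Lemma tangentD (x y : tvec M) : is_tangent p x -> is_tangent p y ->
  is_tangent p (x + y).
Proof. by move=> tx ty; rewrite -[x]scale1r; exact: tangent_linear. Qed.

Lemma tangentZ (a : R) (x : tvec M) : is_tangent p x -> is_tangent p (a *: x).
Proof.
by move=> tx; rewrite -[_ *: _]addr0; apply: tangent_linear => //; exact: tangent0.
Qed.

Lemma tangentN (x : tvec M) : is_tangent p x -> is_tangent p (- x).
Proof. by move=> tx; rewrite -scaleN1r; exact: tangentZ. Qed.

Lemma metric_eq0 x : is_tangent p x -> g p x x = 0 -> x = 0.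
Proof.
move=> tx gx; apply/not_notP => x0; have [_ _ gp _] := hg.
by have := gp _ _ tx x0; rewrite gx ltxx.
Qed.

Lemma metric_sum N (k : 'I_N -> R) (e : 'I_N -> tvec M) z :
  (forall a, is_tangent p (e a)) -> is_tangent p z ->
  g p (\sum_a k a *: e a) z = \sum_a k a * g p (e a) z.
Proof.
move=> te tz; suff [_ //] : is_tangent p (\sum_a k a *: e a) /\
  g p (\sum_a k a *: e a) z = \sum_a k a * g p (e a) z.
elim/big_rec2: _ => [|a s t _ [tt <-]].
  by split; [exact: tangent0|exact: metric0l].
by split; [exact: tangent_linear|rewrite metric_linear].
Qed.
End RiemannianPointwise.

Section AlmostContactPointwise.
Variables (R : realType) (m : nat) (M : complexManifold R m).
Variables (h : hermitian_structure M) (A : almost_contact h) (i : acI A).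
Variables (p : M) (ip : acdom i p).
Local Notation g := (hg h p).
Local Notation J := (hJ h p).
Local Notation G := (acG i p).
Local Notation H := (acH i p).
Local Notation U := (acU i p).
Local Notation V := (acV i p).
Local Notation tan := (is_tangent p).
Let hgP := hgP h.

Lemma tan_J x : tan x -> tan (J x).
Proof. by move=> tx; have [] := hJP h tx. Qed.
Lemma tan_G x : tan x -> tan (G x).
Proof. by move=> tx; have [[+ _ _] _] := ac_tensors i; exact. Qed.
Lemma tan_H x : tan x -> tan (H x).
Proof. by move=> tx; have [_ [+ _ _]] := ac_tensors i; exact. Qed.
Lemma tan_U : tan U. Proof. by have [[+ _] _] := ac_vfields i; exact. Qed.
Lemma tan_V : tan V. Proof. by have [_ [+ _]] := ac_vfields i; exact. Qed.

Lemma hJ0 : J 0 = 0.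
Proof.
have t0 := @tangent0 _ _ M p; apply: (metric_eq0 hgP (tan_J t0)).
by rewrite hgJ// (metric0l hgP).
Qed.

Lemma acGN x : tan x -> G (- x) = - G x.
Proof.
move=> tx; have [[_ Gl _] _] := ac_tensors i.
have t0 := @tangent0 _ _ M p.
have G0 : G 0 = 0.
  have := Gl p 1 0 0 ip t0 t0; rewrite !scale1r addr0 => e.
  by apply: (addIr (G 0)); rewrite -e add0r.
by have := Gl p (-1) x 0 ip tx t0; rewrite !scaleN1r G0 !addr0.
Qed.

Lemma acG_acV : G V = 0.
Proof.
have tU := tan_U; rewrite ac_VE// acGN; last exact: tan_J.
by rewrite ac_GJ// ac_GU// hJ0 !oppr0.
Qed.

Lemma acH_acU : H U = 0.
Proof. by rewrite (ac_HE ip tan_U) (ac_GJ ip tan_U) ac_GU// hJ0 oppr0. Qed.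

Lemma acH_acV : H V = 0.
Proof. by rewrite (ac_HE ip tan_V) (ac_GJ ip tan_V) acG_acV// hJ0 oppr0. Qed.

Lemma acH_acG x : tan x -> H (G x) = - G (H x).
Proof.
move=> tx; rewrite (ac_HE ip (tan_G tx)) (ac_HE ip tx) (ac_GJ ip tx).
have e : J (G x) = - G (J x) by rewrite (ac_GJ ip tx) opprK.
by rewrite -(ac_GJ ip tx) e !acGN//; do ?apply: tan_G; exact: tan_J.
Qed.

Lemma g_acU_acG x : tan x -> g U (G x) = 0.
Proof.
by move=> tx; rewrite (ac_skew ip tan_U tx) ac_GU// (metric0l hgP)// oppr0.
Qed.
Lemma g_acV_acG x : tan x -> g V (G x) = 0.
Proof.
by move=> tx; rewrite (ac_skew ip tan_V tx) acG_acV (metric0l hgP)// oppr0.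
Qed.

Lemma ac_uE x : tan x -> acu i p x = g U x.
Proof. by move=> tx; have [] := ac_dual ip tx. Qed.
Lemma ac_vgE x : tan x -> acv i p x = g V x.
Proof. by move=> tx; have [] := ac_dual ip tx. Qed.

(** H = G J is skew because J is an isometry and J^2 = -1 up to vertical vectors;
    the latter follows from comparing H^2 with G^2, so that no coordinate
    description of J is needed. *)
Lemma acH_skew x y : tan x -> tan y -> g x (H y) = - g (H x) y.
Proof.
move=> tx ty; have tJy := tan_J ty; have tJJy := tan_J tJy.
have tJx := tan_J tx; have tGJx := tan_G tJx.
have JJ : J (J y) = H (H y) + acu i p (J (J y)) *: U + acv i p (J (J y)) *: V.
  have [GGJJ _] := ac_square ip tJJy.
  have : G (G (J (J y))) = - H (H y).
    rewrite (ac_HE ip ty) (ac_HE ip (tan_G tJy)) (ac_GJ ip tJy) acGN ?opprK //.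
    exact/tan_J/tan_G.
  rewrite GGJJ => e; rewrite -[H (H y)]opprK -e !opprD !opprK.
  by rewrite [RHS]addrAC !subrK.
rewrite (ac_HE ip ty) (ac_skew ip tx tJy) -(hgJ h (tan_G tx) tJy).
have -> : J (G x) = - G (J x) by rewrite (ac_GJ ip tx) opprK.
rewrite (metricN hgP tGJx tJJy) opprK -(ac_HE ip tx).
have tHx := tan_H tx; have [_ HH] := ac_square ip ty.
rewrite (metric_sym hgP tHx tJJy) JJ HH.
have tHy : tan (- y + acu i p y *: U + acv i p y *: V).
  by rewrite -HH; exact/tan_H/tan_H.
have tU := tan_U; have tV := tan_V.
have gU : g U (H x) = 0 by rewrite (ac_HE ip tx) g_acU_acG.
have gV : g V (H x) = 0 by rewrite (ac_HE ip tx) g_acV_acG.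
have D a b z : tan z -> g (z + a *: U + b *: V) (H x) = g z (H x).
  move=> tz; rewrite !(metricD hgP) ?(metricZ hgP) ?gU ?gV ?mulr0 ?addr0 //;
  by do ?[apply: tangentD|apply: tangentZ].
by rewrite !D// ?(metricN hgP)// ?(metric_sym hgP ty)//; exact: tangentN.
Qed.
End AlmostContactPointwise.

(** * The contact calculus of a normal complex contact metric manifold *)

Section ContactBridge.
Variables (R : realType) (n : nat) (M : complexManifold R n.*2.+1).
Variables (h : hermitian_structure M) (D : M -> tvec M -> vfield M -> tvec M).
Variables (hD : levi_civita (hg h) D) (C : complex_contact M).
Variables (A : almost_contact h) (hCM : contact_metric D C A).
Variables (hN : normal_contact D C A) (i : acI A).
Variables (W : opens M) (hWi : oset W `<=` acdom i).
Local Notation L := (sfield W).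
Local Notation gs := (smetric (hgP h)).
Local Notation Ds := (sconn hD).

Lemma in_dom (q : pts W) : acdom i (sval q). Proof. exact/hWi/sval_in. Qed.

Lemma U_smooth : smooth_vfield W (acU i).
Proof. by apply: (smooth_vfieldS hWi); have [] := ac_vfields i. Qed.
Lemma V_smooth : smooth_vfield W (acV i).
Proof. by apply: (smooth_vfieldS hWi); have [] := ac_vfields i. Qed.
Definition sU : L := mk_sfield U_smooth.
Definition sV : L := mk_sfield V_smooth.

Lemma G_smooth X' : smooth_vfield W X' ->
  smooth_vfield W (fun q => acG i q (X' q)).
Proof.
have [[_ _ sG] _] := ac_tensors i.
by apply: sG; [exact: osetP|exact: hWi].
Qed.
Lemma H_smooth X' : smooth_vfield W X' ->
  smooth_vfield W (fun q => acH i q (X' q)).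
Proof.
have [_ [_ _ sH]] := ac_tensors i.
by apply: sH; [exact: osetP|exact: hWi].
Qed.

Definition sG (X : L) : L := mk_sfield (G_smooth (ext_smooth_field X)).
Definition sH (X : L) : L := mk_sfield (H_smooth (ext_smooth_field X)).
Lemma sGE X q : sG X q = acG i (sval q) (X q).
Proof. by rewrite /= /res extE. Qed.
Lemma sHE X q : sH X q = acH i (sval q) (X q).
Proof. by rewrite /= /res extE. Qed.

Lemma guE (X : L) q : gs sU X q = acu i (sval q) (X q).
Proof. by rewrite smetricE ac_uE//; [exact: in_dom|exact: ext_tangent]. Qed.
Lemma gvE (X : L) q : gs sV X q = acv i (sval q) (X q).
Proof. by rewrite smetricE ac_vgE//; [exact: in_dom|exact: ext_tangent]. Qed.

Lemma sigmaE (X : L) q :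
  sigma gs Ds sU sV X q = contact_sigma D i (sval q) (X q).
Proof. by rewrite /sigma smetricE (sconnE hD _ _ U_smooth). Qed.

Lemma extends_U : extends sU (acU i). Proof. by split=> //; exact: U_smooth. Qed.
Lemma extends_V : extends sV (acV i). Proof. by split=> //; exact: V_smooth. Qed.

Lemma covE (B : M -> tvec M -> tvec M) (sB : L -> L) (X Y : L) (Y' : vfield M) q :
  (forall X q, sB X q = B (sval q) (X q)) ->
  (forall X', smooth_vfield W X' -> smooth_vfield W (fun q => B q (X' q))) ->
  extends Y Y' ->
  cov Ds sB X Y q = covtensor D B (sval q) (X q) Y'.
Proof.
move=> BE Bs [sY YY']; rewrite /cov sfieldDE sfieldNE BE (sconnE hD X q sY YY').
by rewrite (sconnE hD X q (Bs _ sY))// => r; rewrite BE YY'.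
Qed.

Lemma nijE (B : M -> tvec M -> tvec M) (sB : L -> L) (X Y : L)
    (X' Y' : vfield M) q :
  (forall X q, sB X q = B (sval q) (X q)) ->
  (forall X', smooth_vfield W X' -> smooth_vfield W (fun q => B q (X' q))) ->
  extends X X' -> extends Y Y' ->
  nij Ds sB X Y q = nijenhuis D B X' Y' (sval q).
Proof.
move=> BE Bs eX eY; rewrite /nij /nijenhuis.
change (cov Ds sB (sB X) Y q - cov Ds sB (sB Y) X q - sB (cov Ds sB X Y) q
  + sB (cov Ds sB Y X) q = nijenhuis D B X' Y' (sval q)).
rewrite !BE.
rewrite !(covE _ _ BE Bs eX) !(covE _ _ BE Bs eY) !BE.
by case: eX eY => [_ ->] [_ ->].
Qed.

Lemma tensor_SE X Y X' Y' q : extends X X' -> extends Y Y' ->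
  tensor_S gs Ds sU sV sG sH X Y q = tensorS D i X' Y' (sval q).
Proof.
move=> eX eY; rewrite /tensor_S /tensorS -(nijE q sGE G_smooth eX eY).
move: (nij Ds sG X Y) => N.
rewrite !(sfieldDE, sfieldNE, sfieldZE, sfunME) !sigmaE !gvE !smetricE !sGE !sHE.
by case: eX eY => [_ ->] [_ ->].
Qed.

Lemma tensor_TE X Y X' Y' q : extends X X' -> extends Y Y' ->
  tensor_T gs Ds sU sV sG sH X Y q = tensorT D i X' Y' (sval q).
Proof.
move=> eX eY; rewrite /tensor_T /tensorT -(nijE q sHE H_smooth eX eY).
move: (nij Ds sH X Y) => N.
rewrite !(sfieldDE, sfieldNE, sfieldZE, sfunME) !sigmaE !guE !smetricE !sGE !sHE.
by case: eX eY => [_ ->] [_ ->].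
Qed.

(** The contact form theta is a nonvanishing multiple of u - i v. *)
Lemma horizontalE (q : pts W) x : is_tangent (sval q) x ->
  horizontal C (sval q) x <-> acu i (sval q) x = 0 /\ acv i (sval q) x = 0.
Proof.
move=> tx; split=> [[_ hx]|[ux vx]].
  have [j jq] := ct_cover C (sval q); have := hx j jq.
  have [f /(_ _ jq (in_dom q)) [f0 fE]] := cm_theta hCM j i.
  rewrite fE// => /eqP; rewrite mulf_eq0 (negbTE (introN eqP f0)) /=.
  by rewrite eq_complex /= oppr_eq0 => /andP[/eqP ? /eqP ?].
split=> // j jq; have [f /(_ _ jq (in_dom q)) [_ ->//]] := cm_theta hCM j i.
by rewrite ux vx; apply/eqP; rewrite mulf_eq0 eq_complex /= oppr0 !eqxx orbT.
Qed.

Lemma hor_ext X : hor gs sU sV X -> horizontal_vfield C W (ext X).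
Proof.
move=> [uX vX]; split=> [|r Wr]; first exact: ext_smooth_field.
rewrite -[r]/(sval (exist (oset W) r Wr)) extE; apply/horizontalE.
  exact: ext_tangent.
by rewrite -guE -gvE uX vX.
Qed.

(** Passing from total forms and fields to those on W does not change exterior
    derivatives. *)
Lemma dformE (w : M -> tvec M -> R) (sw : L -> sfun W) X Y X' Y' (q : pts W) :
  (forall (Z : L) (r : pts W), sw Z r = w (sval r) (Z r)) ->
  extends X X' -> extends Y Y' ->
  2 * dform w X' Y' (sval q)
  = (sder X (sw Y) - sder Y (sw X) - sw (br Ds X Y)) q.
Proof.
move=> wE [sX XX'] [sY YY'].
rewrite !(sfunDE, sfunNE) wE (sbrE hD q sX XX' sY YY') !sderE.
rewrite /dform mulrA divff ?mul1r ?pnatr_eq0//.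
have ext_w (Z : L) (Z' : vfield M) r :
    (forall q, Z q = Z' (sval q)) -> oset W r ->
    ext (sw Z) r = w r (Z' r).
  by move=> ZZ' Wr; rewrite -[r]/(sval (exist (oset W) r Wr)) extE wE ZZ'.
congr (_ - _ - _); rewrite -?XX' -?YY'; symmetry.
  apply: (tangent_local (ext_tangent X q) (osetP W) (sval_in q)).
    exact: ext_smooth_fun.
  by move=> r Wr; exact: ext_w.
apply: (tangent_local (ext_tangent Y q) (osetP W) (sval_in q)).
  exact: ext_smooth_fun.
by move=> r Wr; exact: ext_w.
Qed.

Lemma smooth_contact_calculus : contact_calculus (sder (W:=W)) gs Ds sU sV sG sH.
Proof.
have UE q : sU q = acU i (sval q) by [].
have VE q : sV q = acV i (sval q) by [].
have tX (X : L) q : is_tangent (sval q) (X q) by exact: ext_tangent.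
split.
- move=> a X Y; apply: sfield_eq => q; rewrite sfieldDE sfieldZE !sGE.
  have [[_ + _] _] := ac_tensors i; apply; by [exact: in_dom|exact: tX].
- move=> a X Y; apply: sfield_eq => q; rewrite sfieldDE sfieldZE !sHE.
  have [_ [_ + _]] := ac_tensors i; apply; by [exact: in_dom|exact: tX].
- by apply: sfun_eq => q; rewrite guE; have [] := ac_unit (in_dom q).
- by apply: sfun_eq => q; rewrite gvE; have [] := ac_unit (in_dom q).
- by apply: sfun_eq => q; rewrite guE; have [] := ac_unit (in_dom q).
- by apply: sfield_eq => q; rewrite sGE ac_GU//; exact: in_dom.
- by apply: sfield_eq => q; rewrite sGE acG_acV//; exact: in_dom.
- by apply: sfield_eq => q; rewrite sHE acH_acU//; exact: in_dom.
- by apply: sfield_eq => q; rewrite sHE acH_acV//; exact: in_dom.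
- move=> X; apply: sfield_eq => q.
  rewrite !sfieldDE sfieldNE !sfieldZE !sGE guE gvE.
  by have [] := ac_square (in_dom q) (tX X q).
- move=> X; apply: sfield_eq => q.
  rewrite !sfieldDE sfieldNE !sfieldZE !sHE guE gvE.
  by have [] := ac_square (in_dom q) (tX X q).
- move=> X; apply: sfield_eq => q; rewrite sfieldNE sHE !sGE sHE.
  by apply: acH_acG; [exact: in_dom|exact: tX].
- move=> X Y; apply: sfun_eq => q; rewrite sfunNE !smetricE !sGE.
  by apply: ac_skew; [exact: in_dom|exact: tX..].
- move=> X Y; apply: sfun_eq => q; rewrite sfunNE !smetricE !sHE.
  by apply: acH_skew; [exact: in_dom|exact: tX..].
- move=> X Y; apply: sfun_eq => q.
  rewrite -(dformE q guE (extends_ext X) (extends_ext Y)).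
  rewrite (cm_du hCM (osetP W) hWi (ext_smooth_field X) (ext_smooth_field Y)
    (sval_in q)) !(sfunDE, sfunNE, sfunME, sfun1E) !sigmaE !gvE smetricE sGE !extE.
  by field.
- move=> X Y; apply: sfun_eq => q.
  rewrite -(dformE q gvE (extends_ext X) (extends_ext Y)).
  rewrite (cm_dv hCM (osetP W) hWi (ext_smooth_field X) (ext_smooth_field Y)
    (sval_in q)) !(sfunDE, sfunNE, sfunME, sfun1E) !sigmaE !guE smetricE sHE !extE.
  by field.
- move=> X Y hX hY; apply: sfield_eq => q.
  rewrite (tensor_SE _ (extends_ext X) (extends_ext Y)).
  by have [] := hN.1 i W (ext X) (ext Y) (sval q) (osetP W) hWi
    (hor_ext hX) (hor_ext hY) (sval_in q).
- move=> X Y hX hY; apply: sfield_eq => q.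
  rewrite (tensor_TE _ (extends_ext X) (extends_ext Y)).
  by have [] := hN.1 i W (ext X) (ext Y) (sval q) (osetP W) hWi
    (hor_ext hX) (hor_ext hY) (sval_in q).
- move=> X; apply: sfield_eq => q; rewrite (tensor_SE _ (extends_ext X) extends_U).
  by have [] := hN.2 i W (ext X) (sval q) (osetP W) hWi
    (ext_smooth_field X) (sval_in q).
- move=> X; apply: sfield_eq => q; rewrite (tensor_TE _ (extends_ext X) extends_V).
  by have [] := hN.2 i W (ext X) (sval q) (osetP W) hWi
    (ext_smooth_field X) (sval_in q).
Qed.

Lemma extends_conn (X Y : L) X' Y' : extends X X' -> extends Y Y' ->
  extends (Ds X Y) (fun q => D q (X' q) Y').
Proof.
move=> [sX XX'] [sY YY']; split.
  by apply: (conn_smooth (lc_conn hD)) => //; exact: osetP.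
by move=> q; rewrite (sconnE hD X q sY YY') XX'.
Qed.

Lemma curvE X Y Z X' Y' Z' (q : pts W) :
  extends X X' -> extends Y Y' -> extends Z Z' ->
  curv Ds X Y Z q = curvature D X' Y' Z' (sval q).
Proof.
move=> eX eY eZ; have [sX XX'] := eX; have [sY YY'] := eY; have [sZ ZZ'] := eZ.
have [sXZ XZ] := extends_conn eX eZ; have [sYZ YZ] := extends_conn eY eZ.
rewrite /curv /curvature.
change (Ds X (Ds Y Z) q - Ds Y (Ds X Z) q - Ds (br Ds X Y) Z q
  = curvature D X' Y' Z' (sval q)).
rewrite (sconnE hD X q sYZ YZ) (sconnE hD Y q sXZ XZ) (sconnE hD _ q sZ ZZ').
by rewrite (sbrE hD q sX XX' sY YY') XX' YY'.
Qed.

Section Frame.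
Variables (N : nat) (E : 'I_N -> vfield M) (hE : orthonormal_frame (hg h) W E).

Lemma frame_smooth a : smooth_vfield W (E a).
Proof. by have [+ _ _] := hE; apply. Qed.
Definition sE a : L := mk_sfield (frame_smooth a).

Lemma extends_E a : extends (sE a) (E a).
Proof. by split=> //; exact: frame_smooth. Qed.

Lemma sE_orthonormal a b : gs (sE a) (sE b) = (a == b)%:R.
Proof.
have [_ Eon _] := hE.
by apply: sfun_eq => q; rewrite smetricE sfun_natr; apply: Eon; exact: sval_in.
Qed.

Lemma sE_span X : X = \sum_a gs X (sE a) *: sE a.
Proof.
have [_ Eon Esp] := hE; apply: sfield_eq => q; rewrite sfield_sum.
have [k kE] := Esp _ _ (sval_in q) (ext_tangent X q).
rewrite [LHS]kE; apply: eq_bigr => a _; rewrite sfieldZE smetricE kE.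
have tE b : is_tangent (sval q) (E b (sval q)).
  by apply: (frame_smooth b).1; exact: sval_in.
rewrite (metric_sum (hgP h) _ tE (tE a)) (bigD1 a) //= big1 => [|b ba].
  by rewrite (Eon _ _ _ (sval_in q)) eqxx mulr1 addr0.
by rewrite (Eon _ _ _ (sval_in q)) (negbTE ba) mulr0.
Qed.

Lemma ricE X Y X' Y' (q : pts W) : extends X X' -> extends Y Y' ->
  ric gs Ds sE X Y q = ricci (hg h) D E X' Y' (sval q).
Proof.
move=> eX eY; rewrite /ric sfun_sum; apply: eq_bigr => a _.
by rewrite smetricE (curvE q (extends_E a) eX eY).
Qed.
End Frame.
End ContactBridge.

Theorem theorem8 (R : realType) (n : nat) (M : complexManifold R n.*2.+1)
    (h : hermitian_structure M) (D : M -> tvec M -> vfield M -> tvec M)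
    (hD : levi_civita (hg h) D) (C : complex_contact M)
    (A : almost_contact h) (hCM : contact_metric D C A)
    (hN : normal_contact D C A) (i : acI A) (W : set M) (hW : open W)
    (hWi : W `<=` acdom i) (E : 'I_(2 * n.*2.+1) -> vfield M)
    (hE : orthonormal_frame (hg h) W E) (p : M) (hp : W p) :
  let rho := fun X Y : vfield M => ricci (hg h) D E X Y p in
  let U := acU i in
  let V := acV i in
  let ds := dform (contact_sigma D i) U V p in
  (forall X : vfield M, horizontal_vfield C W X ->
     rho X U = 0 /\ rho X V = 0) /\
  [/\ rho U U = (4 * n)%:R - 2 * ds,
      rho V V = (4 * n)%:R - 2 * ds &
      rho U V = 0].
Proof.
pose Wo := Opens hW; have hWo : oset Wo `<=` acdom i by [].
have hEo : orthonormal_frame (hg h) (oset Wo) E by [].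
pose q : pts Wo := exist (oset Wo) p hp.
have lc := smooth_lc_calculus Wo (hgP h) hD.
have cc := smooth_contact_calculus hD hCM hN hWo.
have [rhor [rUU rVV rUV]] :=
  ricci_vertical lc cc (sE_orthonormal hEo) (sE_span hEo).
have eU := extends_U hWo; have eV := extends_V hWo.
have rE X Y X' Y' := @ricE _ _ _ _ _ hD Wo _ _ hEo X Y X' Y' q.
have dsE : 2 * dform (contact_sigma D i) (acU i) (acV i) p
    = dsigma2 (sder (W:=Wo)) (smetric (hgP h)) (sconn hD) (sU hWo) (sV hWo)
        (sU hWo) (sV hWo) q.
  rewrite -[p]/(sval q).
  by rewrite (dformE (w := contact_sigma D i) hD q (sigmaE hD hWo) eU eV).
have NE : ((2 * n.*2.+1)%:R - 2 : sfun Wo) q = (4 * n)%:R.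
  rewrite sfunDE sfunNE !sfun_natr -muln2 natrM -natr1 !natrM; ring.
have subE (a b : sfun Wo) : (a - b) q = a q - b q by [].
move=> rho U V ds; rewrite /rho /ds /U /V -[p]/(sval q); split=> [X [sX hX]|].
  pose X' : sfield Wo := mk_sfield (W := Wo) sX.
  have eX : extends X' X by [].
  have hX' : hor (smetric (hgP h)) (sU hWo) (sV hWo) X'.
    have uv r : acu i (sval r) (X' r) = 0 /\ acv i (sval r) (X' r) = 0.
      apply/(horizontalE hCM hWo); first exact: ext_tangent.
      exact: (hX (sval r) (sval_in r)).
    by split; apply: sfun_eq => r; rewrite ?guE ?gvE; have [] := uv r.
  have [rU rV] := rhor _ hX'.
  by rewrite -(rE _ _ _ _ eX eU) -(rE _ _ _ _ eX eV) rU rV.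
rewrite -(rE _ _ _ _ eU eU) -(rE _ _ _ _ eV eV) -(rE _ _ _ _ eU eV).
by rewrite rUU rVV rUV dsE -NE subE.
Qed.
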